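(* (a) For every planar graph $G$ we have $\chi(G^{[\natural 3]})\le 105$. (b) There exists a planar graph $G_5$ such that $\chi(G_5^{[\natural 3]})=7$.
   Context: All graphs are finite, undirected, simple and without loops. $\chi$ denotes the chromatic number. For a graph $G=(V,E)$ and a positive integer $p$, the exact distance-$p$ graph $G^{[\natural p]}$ has vertex set $V$, and $xy$ is an edge if and only if the distance between $x$ and $y$ in $G$ is exactly $p$. *)

(* Defs.v *)
From mathcomp Require Import all_boot all_order all_algebra.
From mathcomp Require Import all_classical all_reals all_analysis.

Set Implicit Arguments.
Unset Strict Implicit.
Unset Printing Implicit Defensive.

Import Order.TTheory GRing.Theory Num.Theory.
Import numFieldNormedType.Exports.

Local Open Scope classical_set_scope.

Record sgraph := SGraph {
  vertex :> finType;
  edge : rel vertex;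
  edge_sym : symmetric edge;
  edge_irrefl : irreflexive edge }.

Section Colouring.
Variable G : sgraph.

Definition colourable (k : nat) : bool :=
  [exists c : {ffun G -> 'I_k}, forall x, forall y, edge x y ==> (c x != c y)].

Lemma colourable_card : exists k, colourable k.
Proof.
exists #|G|; apply/existsP; exists [ffun x => enum_rank x].
apply/forallP => x; apply/forallP => y; apply/implyP => xy; rewrite !ffunE.
by apply: contraTneq xy => /enum_rank_inj ->; rewrite edge_irrefl.
Qed.

Definition chromatic_number : nat := ex_minn colourable_card.

End Colouring.

Section ExactDistance.
Variable G : sgraph.

(* Lengths count edges; the path visits x followed by the vertices of s. *)
Definition path_of_length (k : nat) (x y : G) : bool :=
  [exists s : k.-tuple G,
    [&& path (@edge G) x s, uniq (x :: s) & last x s == y]].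

(* False for every k when x and y lie in different components. *)
Definition at_distance (k : nat) (x y : G) : bool :=
  path_of_length k x y && [forall j : 'I_k, ~~ path_of_length j x y].

Lemma path_of_length_sym k : symmetric (path_of_length k).
Proof.
suff sub x y : path_of_length k x y -> path_of_length k y x.
  by move=> x y; apply/idP/idP; exact: sub.
case/existsP=> s /and3P[xs us /eqP sy].
have sz : size (rev (belast x s)) == k by rewrite size_rev size_belast size_tuple.
have E : y :: rev (belast x s) = rev (x :: s) by rewrite (lastI x) rev_rcons sy.
apply/existsP; exists (Tuple sz); apply/and3P; split => /=.
- rewrite -sy rev_path.
  by rewrite (eq_path (e' := @edge G)) // => a b; rewrite edge_sym.
- have : uniq (y :: rev (belast x s)) by rewrite E rev_uniq.
  by [].
- case: (tval s) => [|a r] in sy E *; first by rewrite /= -sy.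
  by rewrite /= rev_cons last_rcons.
Qed.

Lemma at_distance_sym k : symmetric (at_distance k).
Proof.
move=> x y; rewrite /at_distance path_of_length_sym; congr (_ && _).
by apply: eq_forallb => j; rewrite path_of_length_sym.
Qed.

Lemma at_distance_irrefl k : (0 < k)%N -> irreflexive (at_distance k).
Proof.
move=> k0 x; apply/negP => /andP[_ /forallP/(_ (Ordinal k0))/negP]; apply.
by apply/existsP; exists [tuple]; rewrite /= eqxx.
Qed.

Definition exact_distance_graph (p : nat) (p_gt0 : (0 < p)%N) : sgraph :=
  SGraph (at_distance_sym p) (at_distance_irrefl p_gt0).

End ExactDistance.

Arguments exact_distance_graph G p p_gt0 : clear implicits.

Section Planarity.
Variable R : realType.

Definition arc_between (p q : R * R) (A : set (R * R)) : Prop :=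
  exists f : R -> R * R,
    [/\ {within `[0%R, 1%R], continuous f},
        {in `[0%R, 1%R] &, injective f},
        f 0%R = p, f 1%R = q & A = f @` `[0%R, 1%R]].

(* [A x y] is the arc drawing the edge xy; its values on non-edges are
   irrelevant. *)
Definition plane_drawing (G : sgraph)
    (v : G -> R * R) (A : G -> G -> set (R * R)) : Prop :=
  let interior x y := A x y `\` [set v x; v y] in
  [/\ injective v,
      forall x y, edge x y -> arc_between (v x) (v y) (A x y),
      forall x y, edge x y -> A x y = A y x,
      forall x y, edge x y -> interior x y `&` range v = set0
    & forall x y x' y', edge x y -> edge x' y' ->
        [set x; y] <> [set x'; y'] -> interior x y `&` A x' y' = set0].

Definition planar (G : sgraph) : Prop := exists v A, @plane_drawing G v A.

End Planarity.

(* Main.v *)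
Require Import Defs.
From mathcomp Require Import all_boot zify boolp.

(* Upper bound. Discretising the arcs of a drawing shows that the graph is a minor
   of a square grid, where ray parity of closed walks replaces the Jordan curve
   theorem. This yields a separation property: if A, B and K are disjoint connected
   vertex sets and A is adjacent to B, then there are two vertices of K such that
   every connected subset of K containing both separates A from B inside K.
   Choosing geodesics between such vertices, one removes paths one after the other,
   each isometric in the component it is cut from, so that every remaining
   component sees at most two earlier paths, one of which is a parent of the other.
   Order the vertices by the index of their path and their position on it, and let
   the centre of x be the least vertex of N[x]. If x and y are at distance 3, their
   centres are distinct, and the larger one reaches the smaller one by a walk of
   length 5 above the latter. The path of the smaller centre is reached in three
   steps to a parent, so it is one of 10 paths. Isometry leaves 11 candidates on
   each of them, and only 5 on the path of the larger centre itself. Colouring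
   the centres greedily takes 9 * 11 + 5 + 1 = 105 colours.

   Lower bound. The graph G5 has 33 vertices; an exhaustive search refutes
   6-colourability of its exact distance-3 graph. *)

Set Implicit Arguments.
Unset Strict Implicit.
Unset Printing Implicit Defensive.

(** * Connected vertex sets *)

(** The arcs of a drawing are arbitrary continuous curves, and neither faces nor a triangulation of
    the graph are ever constructed. This is why the separation property speaks of connected sets
    only: such a statement passes from a grid to its minors. The customary argument encloses each
    component in a cycle made of two paths of a triangulation. Here the cycle is replaced by two
    adjacent connected guards, which may swallow anything outside the component, and the two faces
    beside an edge between the guards mark the ends of the next geodesic. That geodesic separates
    the guards, so each new component loses sight of one of them and gains the geodesic instead; the
    number of visible paths stays at two. Only three of the five steps between centres can descend
    to a parent. The larger centre [w] is least in the closed neighbourhood of its vertex [y], hence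
    the next vertex after [y] still has index at least that of [w]. *)

Section Connectivity.
Variables (T : finType) (e : rel T).

Definition within (X : {set T}) : rel T :=
  [rel x y | [&& x \in X, y \in X & e x y]].

Lemma withinE (X : {set T}) x y :
  within X x y = [&& x \in X, y \in X & e x y].
Proof. by []. Qed.

(** The empty set counts as connected, so that an absent guard can be [set0]. *)
Definition conn (X : {set T}) : Prop :=
  {in X &, forall x y, connect (within X) x y}.

Definition adjacent (X Y : {set T}) : bool :=
  [exists x in X, exists y in Y, e x y].

Lemma adjacentP (X Y : {set T}) :
  reflect (exists x y, [/\ x \in X, y \in Y & e x y]) (adjacent X Y).
Proof.
apply: (iffP exists_inP) => [[x xX /exists_inP[y yY exy]]|[x [y [xX yY exy]]]].
  by exists x, y.
by exists x => //; apply/exists_inP; exists y.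
Qed.

Lemma adjacentS (X X' Y Y' : {set T}) :
  X \subset X' -> Y \subset Y' -> adjacent X Y -> adjacent X' Y'.
Proof.
move=> /subsetP sX /subsetP sY /adjacentP[x [y [xX yY exy]]].
by apply/adjacentP; exists x, y; split; [exact: sX | exact: sY |].
Qed.

Lemma adjacentUl (X Y Z : {set T}) :
  adjacent (X :|: Y) Z = adjacent X Z || adjacent Y Z.
Proof.
apply/idP/orP => [/adjacentP[x [z [/setUP[xX|xY] zZ exz]]]|[]].
- by left; apply/adjacentP; exists x, z.
- by right; apply/adjacentP; exists x, z.
- by apply: adjacentS; rewrite ?subsetUl.
- by apply: adjacentS; rewrite ?subsetUr.
Qed.

Lemma connect_withinS (X Y : {set T}) : X \subset Y ->
  subrel (connect (within X)) (connect (within Y)).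
Proof.
move=> /subsetP sXY; apply: connect_sub => x y /and3P[xX yX exy].
by apply: connect1; rewrite withinE (sXY _ xX) (sXY _ yX).
Qed.

Lemma connect_within_mem (X : {set T}) x y :
  connect (within X) x y -> x \in X -> y \in X.
Proof.
move=> /connectP[p]; elim: p x => [|z p IH] x /=; first by move=> _ ->.
by move=> /andP[/and3P[_ zX _] pp] ly _; apply: IH pp ly zX.
Qed.

Lemma conn0 : conn set0.
Proof. by move=> x y; rewrite inE. Qed.

Hypothesis e_sym : symmetric e.

Lemma within_sym (X : {set T}) : symmetric (within X).
Proof. by move=> x y; rewrite !withinE e_sym andbCA. Qed.

Lemma connect_within_sym (X : {set T}) : connect_sym (within X).
Proof. exact/sym_connect_sym/within_sym. Qed.

Lemma adjacent_sym (X Y : {set T}) : adjacent X Y = adjacent Y X.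
Proof.
by apply/adjacentP/adjacentP => -[x [y [xX yY exy]]]; exists y, x;
  split; rewrite // e_sym.
Qed.

Lemma conn_root (X : {set T}) r :
  (forall x, x \in X -> connect (within X) r x) -> conn X.
Proof.
move=> h x y xX yX; apply: connect_trans (h _ yX).
by rewrite connect_within_sym h.
Qed.

Lemma conn_adjacentU (X Y : {set T}) :
  conn X -> conn Y -> adjacent X Y -> conn (X :|: Y).
Proof.
move=> cX cY /adjacentP[x [y [xX yY exy]]]; apply: (@conn_root _ x).
move=> z /setUP[zX|zY].
  by apply: connect_withinS (cX _ _ xX zX); exact: subsetUl.
apply: (@connect_trans _ _ y).
  by apply: connect1; rewrite withinE !inE xX yY exy orbT.
by apply: connect_withinS (cY _ _ yY zY); exact: subsetUr.
Qed.

Definition component (X : {set T}) x := [set y | connect (within X) x y].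

Lemma component_sub (X : {set T}) x : x \in X -> component X x \subset X.
Proof.
by move=> xX; apply/subsetP => y; rewrite inE => /connect_within_mem; apply.
Qed.

Lemma component_refl (X : {set T}) x : x \in component X x.
Proof. by rewrite inE connect0. Qed.

Lemma component_step (X : {set T}) x y z :
  x \in X -> y \in component X x -> z \in X -> e y z -> z \in component X x.
Proof.
move=> xX; rewrite !inE => cxy zX eyz; have yX := connect_within_mem cxy xX.
by apply: connect_trans cxy (connect1 _); rewrite withinE yX zX.
Qed.

Lemma connect_component (X : {set T}) x y : x \in X ->
  connect (within X) x y -> connect (within (component X x)) x y.
Proof.
move=> xX /connectP[p]; elim/last_ind: p y => [|p z IH] y.
  by move=> _ ->; exact: connect0.
rewrite rcons_path last_rcons => /andP[pp /and3P[lX zX lz]] ->.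
have c1 := IH _ pp erefl; apply: connect_trans c1 _; apply: connect1.
have lC : last x p \in component X x by rewrite inE; apply/connectP; exists p.
by rewrite withinE lC lz (component_step xX lC zX lz).
Qed.

Lemma component_conn (X : {set T}) x : x \in X -> conn (component X x).
Proof.
move=> xX; apply: (@conn_root _ x) => y; rewrite inE.
exact: connect_component.
Qed.

Lemma component_eq (X : {set T}) x y :
  y \in component X x -> component X y = component X x.
Proof.
rewrite inE => cxy; apply/setP => z; rewrite !inE.
by rewrite (same_connect (@connect_within_sym X) cxy).
Qed.

Lemma conn_component (X K : {set T}) x :
  conn K -> x \in K -> K \subset X -> K \subset component X x.
Proof.
move=> cK xK sKX; apply/subsetP => y yK; rewrite inE.
exact: connect_withinS (cK _ _ xK yK).
Qed.

(* [d] is the distance to the root [r] inside [X]. *)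
Lemma bfs_tree (X : {set T}) r : r \in X -> conn X ->
  exists (f : T -> T) (d : T -> nat),
    [/\ f r = r, d r = 0,
        forall x, x \in X -> x != r -> [/\ f x \in X, e x (f x) & d (f x) < d x]
      & forall x y, x \in X -> y \in X -> e x y -> d y <= (d x).+1].
Proof.
move=> rX cX.
have hd x : exists n, x \in X ->
    (exists p, [/\ path (within X) r p, last r p = x & size p = n]) /\
    (forall p, path (within X) r p -> last r p = x -> n <= size p).
  have [xX|nxX] := boolP (x \in X); last by exists 0.
  pose P k := [exists p : k.-tuple T, path (within X) r p && (last r p == x)].
  have exP : exists k, P k.
    have /connectP[p pp lp] := cX _ _ rX xX; exists (size p).
    by apply/existsP; exists (in_tuple p); rewrite pp -lp eqxx.
  case: (ex_minnP exP) => k /existsP[p /andP[pp /eqP lp]] kmin.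
  exists k => _; split; first by exists p; rewrite size_tuple.
  move=> q pq lq; apply: kmin; apply/existsP; exists (in_tuple q).
  by rewrite pq lq eqxx.
have [d dP] := fin_all_exists hd.
have hf x : exists y, (x = r -> y = r) /\ (x \in X -> x != r ->
    [/\ y \in X, e x y & d y < d x]).
  have [->|xr] := eqVneq x r; first by exists r.
  have [xX|nxX] := boolP (x \in X); last by exists r.
  have [[p [pp lp sp]] _] := dP _ xX.
  case/lastP: p pp lp sp => [|p z] /=; first by move=> _ rx; rewrite rx eqxx in xr.
  rewrite rcons_path last_rcons size_rcons => /andP[pp /and3P[lX _ lx]] zx sp.
  rewrite {}zx in lx; exists (last r p); split=> [/eqP|_ _]; first by rewrite (negPf xr).
  split=> //.
    by rewrite e_sym.
  by rewrite -sp ltnS; have [_ dmin] := dP _ lX; apply: dmin.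
have [f fP] := fin_all_exists hf.
exists f, d; split.
- by have [] := fP r => ->.
- by apply/eqP; rewrite -leqn0; have [_ /(_ [::])] := dP _ rX; apply.
- by move=> x xX xr; have [_] := fP x; apply.
- move=> x y xX yX exy; have [[p [pp lp <-]] _] := dP _ xX.
  have [_ /(_ (rcons p y))] := dP _ yX; rewrite size_rcons last_rcons; apply=> //.
  by rewrite rcons_path pp lp withinE xX yX exy.
Qed.

End Connectivity.

(** * Separation in the square grid *)

Definition grid_adj : rel (nat * nat) := fun p q =>
  (p.1 == q.1) && ((p.2.+1 == q.2) || (q.2.+1 == p.2)) ||
  (p.2 == q.2) && ((p.1.+1 == q.1) || (q.1.+1 == p.1)).

(* The face [(i, j)] is the unit square whose upper right corner is the grid
   point [(i, j)]; [side1 p q] and [side2 p q] are the faces separated by the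
   grid edge [pq]. *)
Definition side1 (p q : nat * nat) : nat * nat :=
  if p.1 == q.1 then (p.1, maxn p.2 q.2) else (maxn p.1 q.1, p.2).
Definition side2 (p q : nat * nat) : nat * nat :=
  if p.1 == q.1 then (p.1.+1, maxn p.2 q.2) else (maxn p.1 q.1, p.2.+1).

Definition around (p f : nat * nat) : bool :=
  ((f.1 == p.1) || (f.1 == p.1.+1)) && ((f.2 == p.2) || (f.2 == p.2.+1)).

Definition same_edge (p q u v : nat * nat) : bool :=
  (u == p) && (v == q) || (u == q) && (v == p).

Lemma grid_adj_sym : symmetric grid_adj.
Proof. by move=> [a b] [c d]; rewrite /grid_adj /=; lia. Qed.

Lemma sidesC p q : grid_adj p q ->
  (side1 q p = side1 p q) * (side2 q p = side2 p q).
Proof.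
case: p q => [a b] [c d]; rewrite /grid_adj /side1 /side2 /= => h.
by have [->|ac] := eqVneq a c; split; congr pair; lia.
Qed.

Lemma around_sides p q : grid_adj p q -> around p (side1 p q) && around p (side2 p q).
Proof.
case: p q => [a b] [c d]; rewrite /grid_adj /around /side1 /side2 /= => h.
by have [E|ac] := eqVneq a c => /=; lia.
Qed.

Lemma around_adj p q : grid_adj p q ->
  around q (p.1.+1, p.2.+1) || around p (q.1.+1, q.2.+1).
Proof. by case: p q => [a b] [c d]; rewrite /grid_adj /around /=; lia. Qed.

Lemma grid_adj_ind (P : nat * nat -> nat * nat -> Prop) :
  (forall p q, grid_adj p q -> P p q -> P q p) ->
  (forall a b, P (a, b) (a, b.+1)) -> (forall a b, P (a, b) (a.+1, b)) ->
  forall p q, grid_adj p q -> P p q.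
Proof.
move=> sP P1 P2 [a b] [c d].
case/orP=> /andP[/= /eqP-> /orP[]/eqP<-] //; apply: sP => //;
  by rewrite /grid_adj /= !eqxx ?orbT.
Qed.

Lemma maxnSn n : maxn n n.+1 = n.+1.
Proof. exact/maxn_idPr. Qed.

(** * Crossing parity of closed walks with horizontal rays *)

Section Parity.

Fixpoint parity (h : nat * nat -> nat * nat -> bool) x s : bool :=
  if s is y :: s' then h x y (+) parity h y s' else false.

Lemma parity_cat h x s1 s2 :
  parity h x (s1 ++ s2) = parity h x s1 (+) parity h (last x s1) s2.
Proof. by elim: s1 x => [|y s IH] x //=; rewrite IH addbA. Qed.

Lemma parity_eq h h' (e : rel (nat * nat)) x s : path e x s ->
  (forall u v, e u v -> h u v = h' u v) -> parity h x s = parity h' x s.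
Proof.
by move=> + hh; elim: s x => [|y s IH] x //= /andP[exy /IH->]; rewrite hh.
Qed.

Lemma parity0 x s : parity (fun _ _ => false) x s = false.
Proof. by elim: s x => [|y s IH] x //=; rewrite IH. Qed.

Lemma parityD h h' x s :
  parity (fun u v => h u v (+) h' u v) x s = parity h x s (+) parity h' x s.
Proof. by elim: s x => [|y s IH] x //=; rewrite IH addbACA. Qed.

Lemma parity_telescope (Y : nat * nat -> bool) x s :
  parity (fun u v => Y u (+) Y v) x s = Y x (+) Y (last x s).
Proof.
elim: s x => [|y s IH] x /=; first by rewrite addbb.
by rewrite IH -addbA addKb.
Qed.

(* Does the step [uv] cross the horizontal ray going right from the face [f]? *)
Definition crosses (f u v : nat * nat) : bool :=
  [&& u.1 == v.1, f.1 <= u.1 & maxn u.2 v.2 == f.2].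

Lemma crossesC f p q : crosses f p q = crosses f q p.
Proof.
by rewrite /crosses [q.1 == _]eq_sym [maxn q.2 _]maxnC; have [->|_] := eqVneq p.1 q.1.
Qed.

Lemma same_edgeC p q u v : same_edge p q u v = same_edge q p u v.
Proof. by rewrite /same_edge orbC. Qed.

Lemma same_edgeCr p q u v : same_edge p q u v = same_edge p q v u.
Proof. by rewrite /same_edge orbC andbC [X in _ || X]andbC. Qed.

(** For a vertical edge both rays lie in one row and differ by that edge alone, so [Y] vanishes. For
    a horizontal edge they lie in adjacent rows, and [Y] is the indicator of the half line between
    them that starts at the right end of the edge. The term [Y u (+) Y v] cancels along a closed
    walk. *)
Lemma crosses_sides p q : grid_adj p q -> exists Y : nat * nat -> bool,
  forall u v, grid_adj u v ->
  crosses (side1 p q) u v (+) crosses (side2 p q) u v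
    = Y u (+) Y v (+) same_edge p q u v.
Proof.
move: p q; apply: grid_adj_ind => [p q pq [Y hY]|a b|a b].
- by exists Y => u v uv; rewrite !(sidesC pq) hY // same_edgeC.
- exists (fun=> false); apply: grid_adj_ind => [u v uv|x y|x y].
  + by rewrite !(crossesC _ u v) (same_edgeCr _ _ u v).
  + rewrite /crosses /side1 /side2 /same_edge /= !xpair_eqE !eqxx /=.
    rewrite !maxnSn !eqSS.
    by case: (ltngtP a x); case: (ltngtP y b) => //= *; lia.
  + rewrite /crosses /same_edge /= !xpair_eqE (ltn_eqF (ltnSn x)) /=.
    by lia.
exists (fun u => (u.2 == b) && (a < u.1)).
apply: grid_adj_ind => [u v uv|x y|x y].
- by rewrite !(crossesC _ u v) (same_edgeCr _ _ u v) addbC (addbC (_ && _)) addbC.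
- rewrite /crosses /side1 /side2 /same_edge /= !xpair_eqE (ltn_eqF (ltnSn a)) eqxx /=.
  rewrite !maxnSn !eqSS.
  by case: (ltngtP a x); case: (ltngtP y b) => //= *; lia.
rewrite /crosses /same_edge /= !xpair_eqE (ltn_eqF (ltnSn x)) /=.
by case: (ltngtP a x); case: (ltngtP y b) => //= *; lia.
Qed.

Lemma parity_sides p q x s : grid_adj p q -> path grid_adj x s -> last x s = x ->
  parity (crosses (side1 p q)) x s (+) parity (crosses (side2 p q)) x s
    = parity (same_edge p q) x s.
Proof.
move=> /crosses_sides[Y hY] ps ls.
by rewrite -parityD (parity_eq ps hY) parityD parity_telescope ls addbb.
Qed.

Lemma parity_unused p q x s : p \notin x :: s -> parity (same_edge p q) x s = false.
Proof.
elim: s x => [|y s IH] x //=; rewrite !inE !negb_or => /and3P[px py ps].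
rewrite IH ?inE ?negb_or ?py // /same_edge addbF.
by rewrite eq_sym (negPf px) [y == p]eq_sym (negPf py) andbF.
Qed.

(** Consecutive faces around [p] are separated by an edge at [p], which the walk does not use. The
    edges going up, right and down link all four faces. *)
Lemma parity_around p f x s : 0 < p.2 -> path grid_adj x s -> last x s = x ->
  p \notin x :: s -> around p f ->
  parity (crosses f) x s = parity (crosses (p.1.+1, p.2.+1)) x s.
Proof.
move=> p2 ps ls pn.
have eqs q : grid_adj p q ->
    parity (crosses (side1 p q)) x s = parity (crosses (side2 p q)) x s.
  move=> pq; have := parity_sides pq ps ls; rewrite parity_unused //.
  by case: (parity _ x s); case: (parity _ x s).
case: p p2 pn eqs => a [//|b] _ pn eqs; case: f => i j.
have := eqs (a, b.+2); have := eqs (a.+1, b.+1); have := eqs (a, b).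
rewrite /grid_adj /side1 /side2 /= !eqxx /= ?orbT (gtn_eqF (ltnSn a)) /=.
rewrite (maxn_idPl (leqnSn b)) (maxn_idPr (leqnSn b.+1)) (maxn_idPr (leqnSn a)).
rewrite (ltn_eqF (ltnSn a)).
move=> /(_ isT) h1 /(_ isT) h2 /(_ isT) h3.
rewrite /around /= => /andP[/orP[]/eqP-> /orP[]/eqP->] //.
by rewrite h1 h2.
Qed.

End Parity.

Definition grid_rel (T : Type) (c : T -> nat * nat) : rel T :=
  fun u v => grid_adj (c u) (c v).

Section Separation.
Variables (T : finType) (c : T -> nat * nat).
Hypothesis c_inj : injective c.
Hypothesis c_pos : forall u, (0 < (c u).1) && (0 < (c u).2).

Let e := grid_rel c.

Let e_sym : symmetric e.
Proof. by move=> u v; exact: grid_adj_sym. Qed.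

Variables (X K : {set T}) (r : T) (f : T -> T) (d : T -> nat).
Hypothesis fP : forall x, x \in X -> x != r ->
  [/\ f x \in X, e x (f x) & d (f x) < d x].
Hypothesis K_neq0 : K != set0.

Definition tree_edge u v : bool :=
  [&& u \in X, u != r & v == f u] || [&& v \in X, v != r & u == f v].

(** [reach] spreads over faces through every edge that is not a wall. The closed walk of
    [grid_separable] runs along walls only, so its crossing parity is constant on each class of
    [reach]. *)
Definition wall (p q : nat * nat) : Prop :=
  exists u v, [/\ p = c u, q = c v & [|| tree_edge u v, u \in K | v \in K]].

Inductive reach (L : nat * nat) : nat * nat -> Prop :=
| reach0 : reach L L
| reach12 p q : grid_adj p q -> ~ wall p q -> reach L (side1 p q) -> reach L (side2 p q)
| reach21 p q : grid_adj p q -> ~ wall p q -> reach L (side2 p q) -> reach L (side1 p q).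

Lemma face_const (P : nat * nat -> bool) :
  (forall p q, grid_adj p q -> P (side1 p q) = P (side2 p q)) ->
  forall i j, P (i.+1, j.+1) = P (1, 1).
Proof.
move=> h; have h1 i j : P (i, j.+1) = P (i.+1, j.+1).
  have := h (i, j) (i, j.+1); rewrite /grid_adj /side1 /side2 /= !eqxx maxnSn.
  by apply.
have h2 i j : P (i.+1, j) = P (i.+1, j.+1).
  have := h (i, j) (i.+1, j).
  rewrite /grid_adj /side1 /side2 /= !eqxx maxnSn (ltn_eqF (ltnSn i)).
  by rewrite orbT; apply.
elim=> [|i IHi] j; last by rewrite -h1 IHi.
by elim: j => [|j IHj] //; rewrite -h2 IHj.
Qed.

(* Around a grid point, the boundary of a set of faces has even degree. *)
Lemma boundary_even (P : nat * nat -> bool) p q : (0 < p.1) && (0 < p.2) ->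
  grid_adj p q -> P (side1 p q) != P (side2 p q) ->
  exists q', [/\ q' != q, grid_adj p q' & P (side1 p q') != P (side2 p q')].
Proof.
case: p => -[//|a] [//|b] _ pq hq.
set N := [:: (a.+1, b.+2); (a.+1, b); (a.+2, b.+1); (a, b.+1)].
have qN : q \in N.
  case: q pq {hq} => x y; rewrite /grid_adj /= !inE !xpair_eqE.
  by lia.
have uN : uniq N.
  by rewrite /= !inE !xpair_eqE; lia.
have adjN q' : q' \in N -> grid_adj (a.+1, b.+1) q'.
  by rewrite !inE => /or4P[]/eqP->; rewrite /grid_adj /= !eqxx ?orbT.
have [/hasP[q' q'N /andP[q'q hq']]|/hasPn no] :=
  boolP (has (fun q' => (q' != q) && (P (side1 (a.+1, b.+1) q') != P (side2 (a.+1, b.+1) q'))) N).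
  by exists q'; split=> //; exact: adjN.
have sum0 : \big[addb/false]_(q' <- N) 
    (P (side1 (a.+1, b.+1) q') != P (side2 (a.+1, b.+1) q')) = false.
  rewrite /N !big_cons big_nil /side1 /side2 /= !eqxx.
  rewrite !(gtn_eqF (ltnSn a), ltn_eqF (ltnSn a.+1)).
  rewrite !(maxnSn, maxn_idPl (leqnSn _)).
  by do 4!case: (P _).
move: sum0; rewrite (bigD1_seq q) //= hq big_seq_cond big1 // => q' /andP[q'N q'q].
by have := no _ q'N; rewrite q'q /= => /negPf.
Qed.

(* Otherwise the boundary of the class of [L] lies in the tree, and a deepest
   boundary edge contradicts evenness. *)
Lemma reach_touch i j :
  exists2 k, k \in K & exists2 g, reach (i.+1, j.+1) g & around (c k) g.
Proof.
set L := (i.+1, j.+1).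
have [//|no] := pselect (exists2 k, k \in K & exists2 g, reach L g & around (c k) g).
exfalso; pose P g : bool := `[< reach L g >].
have noK k g : k \in K -> around (c k) g -> P g = false.
  move=> kK ag; apply/negP => /asboolP rg; apply: no; exists k => //.
  by exists g.
have diff_tree p q : grid_adj p q -> P (side1 p q) != P (side2 p q) ->
    exists u v, [/\ p = c u, q = c v & tree_edge u v].
  move=> pq dpq; have [[u [v [pu qv]]]|nw] := pselect (wall p q); last first.
    case/negP: dpq; apply/eqP; apply/idP/idP => /asboolP rg; apply/asboolP.
      exact: reach12.
    exact: reach21.
  have /andP[a1 a2] := around_sides pq.
  have := pq; rewrite grid_adj_sym => qp.
  have := around_sides qp; rewrite !(sidesC pq) => /andP[a3 a4].
  case/or3P => [tr|uK|vK]; first by exists u, v.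
    by rewrite pu qv in a1 a2 dpq; rewrite !(noK u) // in dpq.
  by rewrite pu qv in a3 a4 dpq; rewrite !(noK v) // in dpq.
pose D w := P (side1 (c w) (c (f w))) != P (side2 (c w) (c (f w))).
have nodiff p q : grid_adj p q -> P (side1 p q) = P (side2 p q).
  move=> pq; apply/eqP; apply/negPn/negP => dpq.
  pose Q w := [&& w \in X, w != r & D w].
  have [w0 hw0] : exists w, Q w.
    have [u [v [pu qv]]] := diff_tree _ _ pq dpq.
    case/orP=> /and3P[uX ur /eqP fu].
      by exists u; rewrite /Q uX ur /D -fu -pu -qv.
    by exists v; rewrite /Q uX ur /D -fu -pu -qv !(sidesC pq).
  case: (@arg_maxnP _ w0 Q d hw0) => w /and3P[wX wr dw] wmax.
  have [_ ew _] := fP wX wr.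
  have [q' [q'f adj' dq']] := boundary_even (c_pos w) ew dw.
  have [u [v [/c_inj wu qv]]] := diff_tree _ _ adj' dq'.
  rewrite -wu {wu u} in q'f * => /orP[/and3P[_ _ /eqP vf]|/and3P[vX vr /eqP wf]].
    by rewrite qv vf eqxx in q'f.
  have [_ ev dv] := fP vX vr.
  have : d v <= d w.
    by apply: wmax; rewrite /Q vX vr /D -wf -qv !(sidesC adj').
  by rewrite leqNgt wf dv.
have /set0Pn[k kK] := K_neq0.
have PL : P L by apply/asboolP; exact: reach0.
have := noK k (c k) kK; case: (c k) (c_pos k) => -[//|a] [//|b] /= _.
rewrite (face_const nodiff a b) -(face_const nodiff i j) [P _]PL.
by rewrite /around /= !eqxx => /(_ isT).
Qed.

End Separation.

Lemma positive_sides p q : (0 < p.1) && (0 < p.2) -> (0 < q.1) && (0 < q.2) ->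
  (exists i j, side1 p q = (i.+1, j.+1)) /\ (exists i j, side2 p q = (i.+1, j.+1)).
Proof.
case: p q => [[//|a] [//|b]] [[//|x] [//|y]] _ _.
by rewrite /side1 /side2 /= eqSS !maxnSS; case: ifP => _; split;
  do 2!eexists.
Qed.

(* The only consequence of planarity used for the colouring: in a graph drawn in
   the plane, [k1] and [k2] lie on the faces to the left and to the right of an
   edge between [A] and [B]. *)
Definition separable (T : finType) (e : rel T) : Prop :=
  forall A B K : {set T}, conn e A -> conn e B ->
  [disjoint A & B] -> [disjoint A & K] -> [disjoint B & K] ->
  K != set0 -> adjacent e A B ->
  exists k1 k2, [/\ k1 \in K, k2 \in K &
    forall S C : {set T}, conn e S -> conn e C -> S \subset K -> C \subset K ->
      [disjoint S & C] -> k1 \in S -> k2 \in S ->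
      adjacent e C A -> adjacent e C B -> False].

(** Each of the two faces beside the edge [a0 b0] reaches a face around a point of [K]; these points
    are [k1] and [k2]. If [C] touched both [A] and [B], a closed walk through [A], [C], [B] and back
    along [b0 a0] would use that edge once, so the parities of the two faces would differ. But
    parity is constant on each class of [reach] and along [S], which the walk avoids. *)
Lemma grid_separable (T : finType) (c : T -> nat * nat) :
  injective c -> (forall u, (0 < (c u).1) && (0 < (c u).2)) ->
  separable (grid_rel c).
Proof.
move=> c_inj c_pos A B K; set e := grid_rel c.
have e_sym : symmetric e by move=> u v; exact: grid_adj_sym.
move=> cA cB dAB dAK dBK K0 /adjacentP[a0 [b0 [a0A b0B eab]]].
have [fA [dA [_ _ fAP _]]] := bfs_tree e_sym a0A cA.
have [fB [dB [_ dB0 fBP _]]] := bfs_tree e_sym b0B cB.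
have nAB x : x \in A -> (x \in B) = false by move=> /(disjointFr dAB).
pose X := A :|: B.
(* The trees of [A] and [B] are joined along [a0 b0] into one tree rooted at [b0]. The successor in
   [d] puts [a0] strictly deeper than [b0]. *)
pose f x := if x \in B then fB x else if x == a0 then b0 else fA x.
pose d x := if x \in B then dB x else (dA x).+1.
have fP x : x \in X -> x != b0 -> [/\ f x \in X, e x (f x) & d (f x) < d x].
  rewrite /X /f /d !inE => /orP[xA|xB] xb; last first.
    by have [h1 h2 h3] := fBP _ xB xb; rewrite xB h1 orbT.
  rewrite nAB //; have [->|xa] := eqVneq x a0; first by rewrite b0B orbT dB0.
  by have [h1 h2 h3] := fAP _ xA xa; rewrite h1 nAB.
have [[i1 [j1 L1]] [i2 [j2 L2]]] := positive_sides (c_pos a0) (c_pos b0).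
have [k1 k1K [g1 + ag1]] := reach_touch c_inj c_pos fP K0 i1 j1.
have [k2 k2K [g2 + ag2]] := reach_touch c_inj c_pos fP K0 i2 j2.
rewrite -L1 -L2 => r2 r1.
exists k1, k2; split=> // S C cS cC sSK sCK dSC k1S k2S.
move=> /adjacentP[t1 [x [t1C xA etx]]] /adjacentP[t2 [y [t2C yB ety]]].
pose tr := tree_edge X b0 f.
pose V := A :|: B :|: C.
(* The edge [a0 b0] belongs to the tree but not to [R], as its ends lie in different guards. Hence
   the final step from [b0] to [a0] is its only use by the closed walk. *)
pose R u v := [&& e u v, u \in V, v \in V &
  [|| [&& u \in A, v \in A & tr u v], [&& u \in B, v \in B & tr u v],
      u \in C | v \in C]].
have trC u v : tr u v = tr v u by rewrite /tr /tree_edge orbC.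
have R_sym : symmetric R.
  move=> u v; rewrite /R e_sym trC; congr andb.
  by rewrite !andbA [(u \in V) && _]andbC [(u \in A) && _]andbC
             [(u \in B) && _]andbC [(u \in C) || _]orbC.
have cR := sym_connect_sym R_sym.
have RA u : u \in A -> connect R a0 u.
  have [n] := ubnP (dA u); elim: n u => // n IH u; rewrite ltnS => du uA.
  have [->|ua] := eqVneq u a0; first exact: connect0.
  have [fuA eu dfu] := fAP _ uA ua.
  apply: (@connect_trans _ _ (fA u)); first by apply: IH => //; exact: leq_trans du.
  apply: connect1; rewrite R_sym /R eu /V !inE uA fuA /= /tr /tree_edge /X !inE uA.
  rewrite /f (nAB _ uA) (negPf ua) eqxx.
  by rewrite (contraTneq _ uA) // => ->; rewrite (disjointFl dAB).
have RB u : u \in B -> connect R u b0.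
  have [n] := ubnP (dB u); elim: n u => // n IH u; rewrite ltnS => du uB.
  have [->|ub] := eqVneq u b0; first exact: connect0.
  have [fuB eu dfu] := fBP _ uB ub.
  apply: (@connect_trans _ _ (fB u)); last by apply: IH => //; exact: leq_trans du.
  apply: connect1; rewrite /R eu /V !inE uB fuB !orbT /= /tr /tree_edge /X !inE uB.
  by rewrite /f uB ub eqxx !orbT.
have RC : connect R t1 t2.
  apply: (connect_sub _ (cC _ _ t1C t2C)) => u v /and3P[uC vC euv].
  by apply: connect1; rewrite /R euv /V !inE uC vC !orbT.
have /connectP[p pR lp] : connect R a0 b0.
  apply: connect_trans (RA _ xA) _; apply: connect_trans _ (RB _ yB).
  apply: (@connect_trans _ _ t1).
    by apply: connect1; rewrite R_sym /R etx /V !inE t1C xA !orbT.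
  apply: connect_trans RC (connect1 _).
  by rewrite /R ety /V !inE t2C yB !orbT.
pose s := rcons (map c p) (c a0).
have ls : last (c a0) s = c a0 by rewrite last_rcons.
have pathV q u : u \in V -> path R u q -> {subset u :: q <= V}.
  elim: q u => [|v q IH] u uV /=; first by move=> _ w; rewrite inE => /eqP->.
  move=> /andP[/and4P[_ _ vV _] qR] w; rewrite inE => /orP[/eqP->//|].
  exact: IH qR w.
have pV : {subset a0 :: p <= V} by apply: pathV pR; rewrite /V !inE a0A.
have notin k : k \in S -> c k \notin c a0 :: s.
  move=> kS; rewrite /s -rcons_cons -map_cons mem_rcons inE negb_or.
  have kV : k \notin V.
    have kK := subsetP sSK _ kS.
    by rewrite /V !inE (disjointFl dAK kK) (disjointFl dBK kK) (disjointFr dSC kS).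
  rewrite (mem_map c_inj) (contra (pV k) kV) andbT.
  apply: contra kV => /eqP/c_inj->; apply: pV; exact: mem_head.
have a0b0 : a0 != b0 by apply: contraTneq a0A => ->; rewrite (disjointFl dAB).
have fa0 : f a0 = b0 by rewrite /f (nAB _ a0A) eqxx.
have tr0 : tr b0 a0 by rewrite /tr /tree_edge /X !inE a0A a0b0 fa0 eqxx orbT.
have path_s (h : rel (nat * nat)) : (forall u v, R u v -> h (c u) (c v)) ->
    h (c b0) (c a0) -> path h (c a0) s.
  move=> hR h0; rewrite /s rcons_path path_map last_map -lp h0 andbT.
  by apply: sub_path pR => u v; exact: hR.
have pgs : path grid_adj (c a0) s.
  apply: path_s; last by rewrite grid_adj_sym.
  by move=> u v /and3P[].
pose chi g := parity (crosses g) (c a0) s.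
have chi_reach L g : reach c X K b0 f L g -> chi g = chi L.
  have eq_sides p' q' : grid_adj p' q' -> ~ wall c X K b0 f p' q' ->
      chi (side1 p' q') = chi (side2 p' q').
    move=> pq nw; have := parity_sides pq pgs ls.
    rewrite [RHS](@parity_eq _ (fun _ _ => false) (fun u v => ~~ same_edge p' q' u v)).
    - by rewrite parity0 /chi; case: parity; case: parity.
    - apply: path_s.
        move=> u v /and4P[_ _ _ Ruv]; apply/negP => se; apply: nw.
        have w : [|| tr u v, u \in K | v \in K].
          case/or4P: Ruv => [/and3P[_ _ ->]//|/and3P[_ _ ->]//|uC|vC].
            by rewrite (subsetP sCK) ?orbT.
          by rewrite (subsetP sCK _ vC) ?orbT.
        case/orP: se => /andP[/eqP<- /eqP<-]; first by exists u, v.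
        exists v, u; split=> //; rewrite -/tr trC.
        by case/or3P: w => ->; rewrite ?orbT.
      apply/negP => se; apply: nw.
      case/orP: se => /andP[/eqP<- /eqP<-].
        by exists b0, a0; rewrite -/tr tr0.
      by exists a0, b0; rewrite -/tr trC tr0.
    - by move=> u v /negPf.
  by elim=> // p' q' pq nw _ <-; rewrite eq_sides.
have chi_ne : chi (side1 (c a0) (c b0)) (+) chi (side2 (c a0) (c b0)) = true.
  rewrite /chi parity_sides // /s -cats1 parity_cat /= last_map -lp.
  rewrite {2}/same_edge !eqxx orbT.
  rewrite (@parity_eq _ (fun _ _ => false) (fun u v => ~~ same_edge (c a0) (c b0) u v)).
  - by rewrite parity0.
  - rewrite path_map; apply: sub_path pR => u v Ruv /=; apply/negP.
    rewrite /same_edge !(inj_eq c_inj) => se.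
    have : R a0 b0 by case/orP: se => /andP[/eqP<- /eqP<-] //; rewrite R_sym.
    rewrite /R (nAB _ a0A) (disjointFl dAB b0B) andbF /= => /and4P[_ _ _ /orP[]].
      by move/(subsetP sCK a0); rewrite (disjointFr dAK a0A).
    by move/(subsetP sCK b0); rewrite (disjointFr dBK b0B).
  - by move=> u v /negPf.
have chi_at k g : k \in S -> around (c k) g -> chi g = chi ((c k).1.+1, (c k).2.+1).
  by move=> kS ag; apply: parity_around => //; [have /andP[] := c_pos k | exact: notin].
have chi_S : chi ((c k1).1.+1, (c k1).2.+1) = chi ((c k2).1.+1, (c k2).2.+1).
  (* Adjacent points of [S] share a face, so the parity is passed along [S]. *)
  have /connectP[q] := cS _ _ k1S k2S.
  elim: q k1 k1S {k1K r1 ag1} => [|v q IH] u uS /=; first by move=> _ ->.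
  move=> /andP[/and3P[_ vS euv] pq] lq; rewrite -(IH v) //.
  by have /orP[/(chi_at _ _ vS)|/(chi_at _ _ uS)] := around_adj euv.
move: chi_ne; rewrite -(chi_reach _ _ r1) -(chi_reach _ _ r2).
by rewrite (chi_at _ _ k1S ag1) (chi_at _ _ k2S ag2) chi_S addbb.
Qed.

(** * Partition into isometric paths *)

(** Unions of branch sets preserve connectedness, disjointness and adjacency. The two vertices found
    in [e0] are pulled back to those whose branch sets contain them. *)
Lemma minor_separable (T T0 : finType) (e : rel T) (e0 : rel T0)
    (b : T -> {set T0}) : symmetric e0 ->
  (forall x, b x != set0) -> (forall x, conn e0 (b x)) ->
  (forall x y, x != y -> [disjoint b x & b y]) ->
  (forall x y, e x y -> adjacent e0 (b x) (b y)) ->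
  separable e0 -> separable e.
Proof.
move=> e0_sym b0 bc bd be sep A B K cA cB dAB dAK dBK K0 adjAB.
pose U (X : {set T}) := \bigcup_(x in X) b x.
have bU x (X : {set T}) : x \in X -> b x \subset U X by exact: bigcup_sup.
have connU (X : {set T}) : conn e X -> conn e0 (U X).
  move=> cX u v /bigcupP[x xX ux] /bigcupP[y yX vy].
  have /connectP[p] := cX _ _ xX yX.
  elim: p x xX u ux => [|z p IH] x xX u ux /=.
    by move=> _ yx; rewrite yx in vy; exact: connect_withinS (bU _ _ xX) _ _ (bc _ _ _ ux vy).
  move=> /andP[/and3P[_ zX exz] pp] lp.
  have /adjacentP[s [t [sx tz est]]] := be _ _ exz.
  apply: connect_trans (IH _ zX _ tz pp lp).
  apply: (@connect_trans _ _ s).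
    exact: connect_withinS (bU _ _ xX) _ _ (bc _ _ _ ux sx).
  by apply: connect1; rewrite withinE est (subsetP (bU _ _ xX)) // (subsetP (bU _ _ zX)).
have disjU (X Y : {set T}) : [disjoint X & Y] -> [disjoint U X & U Y].
  move=> dXY; apply/pred0P => u /=; apply/negP => /andP[/bigcupP[x xX ux] /bigcupP[y yY uy]].
  have [xy|/bd/disjointFr/(_ ux)] := eqVneq x y; last by rewrite uy.
  by rewrite xy (disjointFl dXY) in xX.
have adjU (X Y : {set T}) : adjacent e X Y -> adjacent e0 (U X) (U Y).
  by move=> /adjacentP[x [y [xX yY /be]]]; apply: adjacentS; exact: bU.
have subU (X Y : {set T}) : X \subset Y -> U X \subset U Y.
  move=> /subsetP sXY; apply/subsetP => u /bigcupP[x /sXY xY ux].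
  by apply/bigcupP; exists x.
have UK0 : U K != set0.
  have /set0Pn[x xK] := K0; have /set0Pn[u ux] := b0 x.
  by apply/set0Pn; exists u; apply: (subsetP (bU _ _ xK)).
have [k1 [k2 [/bigcupP[x1 x1K k1x] /bigcupP[x2 x2K k2x] h]]] :=
  sep _ _ _ (connU _ cA) (connU _ cB) (disjU _ _ dAB) (disjU _ _ dAK)
    (disjU _ _ dBK) UK0 (adjU _ _ adjAB).
exists x1, x2; split=> // S C cS cC SK CK dSC x1S x2S CA CB.
apply: (h (U S) (U C)) => //.
- exact: connU.
- exact: connU.
- exact: subU.
- exact: subU.
- exact: disjU.
- exact: subsetP (bU _ _ x1S) _ k1x.
- exact: subsetP (bU _ _ x2S) _ k2x.
- exact: adjU.
- exact: adjU.
Qed.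

(** * Cutting a component along a geodesic *)

Section Decomposition.
Variables (T : finType) (e : rel T).
Hypothesis e_sym : symmetric e.

Lemma adjacent0 (X : {set T}) : adjacent e X set0 = false.
Proof. by apply/adjacentP => -[x [y [_]]]; rewrite inE. Qed.

Lemma conn_exit (K D : {set T}) w s : conn e K -> D \subset K ->
  w \in D -> s \in K -> s \notin D ->
  exists z z', [/\ z \in D, z' \in K, z' \notin D & e z z'].
Proof.
move=> cK DK wD sK; have /connectP[p] := cK _ _ (subsetP DK _ wD) sK.
elim: p w wD => [|z p IH] w wD /=; first by move=> _ ->; rewrite wD.
move=> /andP[/and3P[_ zK ewz] pp] lp sD.
have [zD|zD] := boolP (z \in D); first exact: IH zD pp lp sD.
by exists w, z.
Qed.

(** What remains is [S] with the other components of [K :\: S], each of which is attached to [S]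
    because [K] is connected. *)
Lemma conn_setD_component (K S : {set T}) x : conn e K -> conn e S ->
  S \subset K -> S != set0 -> x \in K :\: S ->
  conn e (K :\: component e (K :\: S) x).
Proof.
move=> cK cS SK /set0Pn[s sS] xKS; set C := component _ _ x; set R := K :\: C.
have CKS : C \subset K :\: S by exact: component_sub.
have SR : S \subset R.
  apply/subsetP => z zS; rewrite in_setD (subsetP SK) // andbT.
  by apply/negP => /(subsetP CKS); rewrite inE zS.
apply: (conn_root e_sym (r := s)) => w; rewrite in_setD => /andP[wC wK].
have [wS|wS] := boolP (w \in S); first exact: connect_withinS SR _ _ (cS _ _ sS wS).
have wKS : w \in K :\: S by rewrite inE wS.
set D := component e (K :\: S) w.
have DKS : D \subset K :\: S by exact: component_sub.
have DR : D \subset R.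
  apply/subsetP => z zD; rewrite in_setD; have := subsetP DKS _ zD; rewrite in_setD => /andP[_ ->].
  rewrite andbT; apply: contra wC => zC.
  by rewrite /C -(component_eq e_sym zC) (component_eq e_sym zD) component_refl.
have DK : D \subset K := subset_trans DKS (subsetDl _ _).
have [|z [z' [zD z'K z'D ezz']]] := conn_exit cK DK (component_refl _ _ _) (subsetP SK _ sS).
  by apply/negP => /(subsetP DKS); rewrite inE sS.
have z'S : z' \in S.
  apply: contraNT z'D => z'S; apply: component_step zD _ ezz' => //.
  by rewrite inE z'S.
apply: (connect_withinS (X := S :|: D)); first by rewrite subUset SR.
have cSD : conn e (S :|: D).
  apply: conn_adjacentU => //; first exact: component_conn.
  by apply/adjacentP; exists z', z; rewrite e_sym.
by apply: cSD; rewrite inE ?sS // component_refl orbT.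
Qed.

(** [S] is the orbit of [b] under the parent map of a breadth first tree rooted at [a]. Isometry is
    encoded by [d]: it tells the points of [S] apart and grows by at most one along each edge of
    [K]. *)
Lemma geodesic (K : {set T}) a b : conn e K -> a \in K -> b \in K ->
  exists (S : {set T}) (d : T -> nat),
    [/\ [/\ conn e S, S \subset K, a \in S & b \in S],
        {in S &, injective d}
      & {in K &, forall x y, e x y -> d y <= (d x).+1}].
Proof.
move=> cK aK bK; have [f [d [fa da fP dL]]] := bfs_tree e_sym aK cK.
have fK i : iter i f b \in K.
  elim: i => //= i IH; have [->|/(fP _ IH)[]//] := eqVneq (iter i f b) a.
  by rewrite fa.
have dK i : d (f (iter i f b)) <= d (iter i f b) ?= iff (f (iter i f b) == iter i f b).
  have [->|na] := eqVneq (iter i f b) a; first by rewrite fa eqxx; exact/leqif_refl.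
  have [_ _ lt] := fP _ (fK i) na; split; first exact: ltnW.
  rewrite (ltn_eqF lt); apply/esym/negbTE; apply: contraTneq lt => ->.
  by rewrite ltnn.
have dik i k : d (iter (k + i) f b) <= d (iter i f b) ?= iff (iter (k + i) f b == iter i f b).
  elim: k => [|k IH]; first by split; rewrite ?eqxx.
  rewrite addSn /=; have [le1 eq1] := dK (k + i); have [le2 eq2] := IH.
  split; first exact: leq_trans le1 le2.
  apply/eqP/eqP => [E|->//].
  have E1 : d (f (iter (k + i) f b)) = d (iter (k + i) f b).
    by apply/eqP; rewrite eqn_leq le1 E le2.
  move/eqP: E1; rewrite eq1 => /eqP E1; rewrite E1 in E *.
  by apply/eqP; rewrite -eq2 E.
pose S := [set x | fconnect f b x].
have itS i : iter i f b \in S by rewrite inE fconnect_iter.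
have SP x : x \in S -> exists i, x = iter i f b.
  by rewrite inE => fbx; exists (findex f b x); rewrite iter_findex.
exists S, d; split=> //; first split.
- apply: (conn_root e_sym (r := b)) => x /SP[i ->].
  elim: i => [|i IH]; first exact: connect0.
  have [E|na] := eqVneq (iter i f b) a; first by move: IH; rewrite /= E fa.
  apply: connect_trans IH (connect1 _); rewrite withinE itS (itS i.+1) /=.
  by have [] := fP _ (fK i) na.
- by apply/subsetP => x /SP[i ->].
- have [n] := ubnP (d b); suff h m i : d (iter i f b) <= m -> a \in S.
    by move=> _; exact: (h (d b) 0).
  elim: m i => [|m IH] i di; have [E|/(fP _ (fK i))[_ _ lt]] := eqVneq (iter i f b) a.
  - by rewrite -E.
  - by move: lt; rewrite ltnNge (leq_trans di).
  - by rewrite -E.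
  - by apply: (IH i.+1); rewrite -ltnS (leq_trans lt).
- exact: (itS 0).
- move=> _ _ /SP[i ->] /SP[j ->] E.
  wlog ij : i j E / i <= j => [h|].
    by have [/h->//|/ltnW/h->//] := leqP i j.
  by apply/esym/eqP; have := (dik i (j - i)).2; rewrite subnK // E eqxx => <-.
Qed.

(* The neighbours of the component [K] on earlier paths: those in the guard [A]
   lie on the path with index [a], those in [B] on the path with index [b]. *)
Definition guarded (idx : T -> nat) (K A B : {set T}) (a b : nat) : Prop :=
  [/\ conn e A, conn e B, [disjoint A & K], [disjoint B & K] & [disjoint A & B]] /\
  [\/ A = set0, B = set0 | adjacent e A B] /\
  (forall z z', z \in K -> z' \notin K -> e z z' ->
    z' \in A /\ idx z' = a \/ z' \in B /\ idx z' = b).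

Lemma guardedC idx K A B a b : guarded idx K A B a b -> guarded idx K B A b a.
Proof.
move=> [[cA cB dA dB dAB] [adj N]]; split; first by split=> //; rewrite disjoint_sym.
split=> [|z z' zK z'K ezz'].
  by case: adj => [->|->|h]; [constructor 2 | constructor 1 | constructor 3; rewrite adjacent_sym].
by case: (N _ _ zK z'K ezz'); [right | left].
Qed.

(** If [K] sees both guards, [S] joins the two vertices given by [separable], and no component of
    [K :\: S] sees both. Otherwise a geodesic from one vertex to itself will do, taken next to the
    guard that is seen, if any. [idx'] is kept general because the caller renumbers all remaining
    vertices at once. *)
Lemma guarded_split idx (K A B : {set T}) a b : separable e -> conn e K ->
  K != set0 -> guarded idx K A B a b ->
  exists (S : {set T}) (d : T -> nat),
    [/\ S \subset K, S != set0, {in S &, injective d},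
        {in K &, forall x y, e x y -> d y <= (d x).+1}
      & forall idx' n, {in S, forall z, idx' z = n} ->
          (forall z z', z \in K -> z' \notin K -> e z z' -> idx' z' = idx z') ->
          forall x, x \in K :\: S -> exists A' B' a',
            guarded idx' (component e (K :\: S) x) A' B' a' n /\
            (a' = a \/ a' = b)].
Proof.
move=> sep cK K0 gd.
have K0' := K0; have /set0Pn[k kK] := K0'.
have [S [d [[SK S0 cS] dinj dL]]] : exists (S : {set T}) (d : T -> nat),
  [/\ [/\ S \subset K, S != set0 & conn e S], {in S &, injective d},
      {in K &, forall x y, e x y -> d y <= (d x).+1} &
      if adjacent e K A then
        if adjacent e K B then
          forall C, conn e C -> C \subset K -> [disjoint S & C] ->
            adjacent e C A -> adjacent e C B -> False
        else adjacent e S A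
      else adjacent e K B -> adjacent e S B].
  have single z : z \in K -> exists (S : {set T}) (d : T -> nat),
      [/\ [/\ S \subset K, S != set0 & conn e S], {in S &, injective d},
      {in K &, forall x y, e x y -> d y <= (d x).+1} & z \in S].
    move=> zK; have [S [d [[cS SK zS _] dinj dL]]] := geodesic cK zK zK.
    exists S, d; split=> //; split=> //; by apply/set0Pn; exists z.
  have singleadj Z : adjacent e K Z -> exists (S : {set T}) (d : T -> nat),
      [/\ [/\ S \subset K, S != set0 & conn e S], {in S &, injective d},
      {in K &, forall x y, e x y -> d y <= (d x).+1} & adjacent e S Z].
    move=> /adjacentP[z [y [zK yZ ezy]]]; have [S [d [h1 h2 h3 zS]]] := single z zK.
    by exists S, d; split=> //; apply/adjacentP; exists z, y.
  have [KA|KA] := boolP (adjacent e K A); last first.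
    have [KB|KB] := boolP (adjacent e K B).
      by have [S [d [h1 h2 h3 h4]]] := singleadj _ KB; exists S, d.
    by have [S [d [h1 h2 h3 h4]]] := single _ kK; exists S, d.
  have [KB|KB] := boolP (adjacent e K B); last exact: singleadj.
  have [[cA cB dA dB dAB] [adj N]] := gd.
  have AB : adjacent e A B.
    by case: adj => // E; move: KA KB; rewrite E adjacent0.
  have [k1 [k2 [k1K k2K h]]] := sep _ _ _ cA cB dAB dA dB K0 AB.
  have [S [d [[cS SK k1S k2S] dinj dL]]] := geodesic cK k1K k2K.
  exists S, d; split=> //; first by split=> //; apply/set0Pn; exists k1.
  by move=> C cC CK dSC; apply: h cS cC _ _ _ _ _.
move=> hS; exists S, d; split=> // idx' n idxS idxK x xKS.
set C := component e (K :\: S) x; set R := K :\: C.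
have CKS : C \subset K :\: S by exact: component_sub.
have CK : C \subset K := subset_trans CKS (subsetDl _ _).
have cC : conn e C by exact: component_conn.
have cR : conn e R by exact: conn_setD_component.
have dSC : [disjoint S & C].
  by rewrite disjoint_sym; apply: disjointWl CKS _; rewrite disjoint_sym disjoints_subset;
     apply/subsetP => z; rewrite !inE => ->.
have SR : S \subset R by rewrite subsetD SK.
have KRC : K = R :|: C.
  apply/setP => z; rewrite in_setU in_setD; have [/(subsetP CK)->|_] := boolP (z \in C) => //=.
  by rewrite orbF.
have dRC : [disjoint R & C].
  by rewrite disjoint_sym disjoints_subset; apply/subsetP => z; rewrite !inE => ->.
have NC z z' : z \in C -> z' \notin C -> e z z' -> z' \in K -> z' \in S.
  move=> zC z'C ezz' z'K; apply: contraNT z'C => z'S.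
  by apply: component_step zC _ ezz' => //; rewrite inE z'S.
have RC : adjacent e R C.
  have /set0Pn[s sS] := S0.
  have [|z [z' [zC z'K z'C ezz']]] := conn_exit cK CK (component_refl _ _ _) (subsetP SK _ sS).
    by rewrite -/C (disjointFr dSC).
  by apply/adjacentP; exists z', z; rewrite inE z'C z'K e_sym.
(* The guard [B1], not seen by [C], and the rest [R] of [K] become one guard. *)
have main A1 B1 a1 b1 : guarded idx K A1 B1 a1 b1 -> ~~ adjacent e C B1 ->
    (adjacent e K A1 -> adjacent e K B1 \/ adjacent e S A1) ->
    exists A' B', guarded idx' C A' B' a1 n.
  move=> [[cA cB dA dB dAB] [adj N]] CB hA.
  have dR (Z : {set T}) : [disjoint Z & K] -> [disjoint Z & R].
    by move=> dZ; apply: disjointWr dZ; rewrite KRC subsetUl.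
  have dC (Z : {set T}) : [disjoint Z & K] -> [disjoint Z & C] by apply: disjointWr.
  have N' z z' : z \in C -> z' \notin C -> e z z' ->
      z' \in A1 /\ idx' z' = a1 \/ z' \in R /\ idx' z' = n.
    move=> zC z'C ezz'; have [z'K|z'K] := boolP (z' \in K).
      have z'S := NC _ _ zC z'C ezz' z'K.
      by right; rewrite (subsetP SR) // idxS.
    rewrite (idxK z z' (subsetP CK _ zC) z'K ezz'); 
    case: (N _ _ (subsetP CK _ zC) z'K ezz'); first by left.
    by move=> [z'B _]; case/adjacentP: CB; exists z, z'.
  have [KB|KB] := boolP (adjacent e K B1).
    have RB : adjacent e R B1.
      by move: KB; rewrite KRC adjacentUl (negPf CB) orbF.
    (* [R] need not touch [A1]; keeping [B1] in the merged guard preserves the adjacency of the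
       pair. *)
    exists A1, (B1 :|: R); split; [split=> //|split].
    - by apply: conn_adjacentU => //; rewrite adjacent_sym.
    - exact: dC.
    - by rewrite disjoints_subset subUset -!disjoints_subset (dC _ dB).
    - by rewrite disjoint_sym disjoints_subset subUset -!disjoints_subset
        ![[disjoint _ & A1]]disjoint_sym dAB dR.
    - case: adj => [->|E|AB]; first by constructor 1.
        by move: KB; rewrite E adjacent0.
      by constructor 3; apply: adjacentS AB; rewrite ?subsetUl.
    - move=> z z' zC z'C ezz'; case: (N' _ _ zC z'C ezz'); first by left.
      by move=> [z'R ?]; right; rewrite inE z'R orbT.
  have [KA|KA] := boolP (adjacent e K A1).
    exists A1, R; split; [split=> //; [exact: dC | exact: dR]|split=> //].
    constructor 3; rewrite adjacent_sym //; case: (hA KA); first by rewrite (negPf KB).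
    exact: adjacentS.
  exists set0, R; split; [split=> //|split=> //].
  - exact: conn0.
  - by rewrite -setI_eq0 set0I.
  - by rewrite -setI_eq0 set0I.
  - by constructor 1.
  - move=> z z' zC z'C ezz'; case: (N' _ _ zC z'C ezz'); last by right.
    move=> [z'A _]; case/adjacentP: KA; exists z, z'; split=> //; exact: subsetP CK _ zC.
have adjCK Z : adjacent e C Z -> adjacent e K Z by apply: adjacentS.
have [CB|CB] := boolP (adjacent e C B); last first.
  have [|A' [B' g]] := main _ _ _ _ gd CB.
    by move=> KA; rewrite KA in hS; case: ifP hS; [left | right].
  by exists A', B', a; split=> //; left.
have KB := adjCK _ CB.
have CA : ~~ adjacent e C A.
  apply/negP => CA; have KA := adjCK _ CA; rewrite KA KB in hS.
  exact: hS C cC CK dSC CA CB.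
have [|A' [B' g]] := main _ _ _ _ (guardedC gd) CA.
  by move=> _; case: ifP hS => [KA _|_ /(_ KB)]; [left | right].
by exists A', B', b; split=> //; right.
Qed.

End Decomposition.

Section Partition.
Variables (T : finType) (e : rel T).
Hypothesis e_sym : symmetric e.

Definition upper (idx : T -> nat) i := [set w | i <= idx w].

(* [path_partition_below n] describes the state after the isometric paths of
   index below [n] have been removed; the vertices of index [n] are those left. *)
Record path_partition_below (n : nat) (idx pos : T -> nat) (p q : nat -> nat) : Prop := {
  ppb_parent : forall i, p i < n /\ q i < n;
  ppb_clique : forall i, q i = p (p i) \/ q i = q (p i);
  ppb_inj : forall u v, idx u < n -> idx u = idx v -> pos u = pos v -> u = v;
  ppb_isometric : forall u s, idx u < n ->
    path (within e (upper idx (idx u))) u s -> idx (last u s) = idx u ->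
    pos (last u s) <= pos u + size s;
  ppb_neighbour : forall u z z', idx u < n ->
    connect (within e (upper idx (idx u))) u z -> e z z' -> idx z' < idx u ->
    idx z' = p (idx u) \/ idx z' = q (idx u) }.

(** Each round picks one component [K] of the vertices left, gives index [n] to a geodesic [S] of it
    and [n.+1] to all others left. Components inside [K] get their guards from [guarded_split], the
    other ones keep theirs. *)
Lemma path_partition_extend n idx pos p q : separable e ->
  (forall v, idx v <= n) -> path_partition_below n idx pos p q ->
  (forall v, idx v = n -> exists A B a b,
     [/\ guarded e idx (component e (upper idx n) v) A B a b, a < n, b < n
       & [\/ b = p a, b = q a, a = p b | a = q b]]) ->
  exists m idx' pos' p' q', path_partition_below m idx' pos' p' q' /\
    forall v, idx' v < m.
Proof.
move=> sep; have [k] := ubnP #|upper idx n|.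
elim: k n idx pos p q => // k IH n idx pos p q cardU le_n ppb gd.
have [U0|/set0Pn[v vU]] := eqVneq (upper idx n) set0.
  exists n, idx, pos, p, q; split=> // v; rewrite ltnNge; apply/negP => vn.
  by have : v \in upper idx n; [rewrite inE | rewrite U0 inE].
have idx_v : idx v = n by apply/eqP; rewrite eqn_leq le_n; rewrite inE in vU.
have [A [B [a [b [gK an bn ab]]]]] := gd _ idx_v.
move: gK; set U := upper idx n; set K := component e U v => gK.
have KU : K \subset U by exact: component_sub.
have cK : conn e K by exact: component_conn.
have K0 : K != set0 by apply/set0Pn; exists v; exact: component_refl.
have [S [d [SK S0 dinj dL hS]]] := guarded_split e_sym sep cK K0 gK.
have SU : S \subset U := subset_trans SK KU.
have Un z : z \in U -> idx z = n by rewrite inE => nz; apply/eqP; rewrite eqn_leq le_n.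
have nU z : z \notin U -> idx z < n by rewrite inE -ltnNge.
have n0 : 0 < n by case: (ppb_parent ppb 0) => h _; exact: leq_ltn_trans h.
pose idx' z := if z \in S then n else if z \in U then n.+1 else idx z.
pose pos' z := if z \in S then d z else pos z.
(* The guards are unordered, whereas [ppb_clique] needs [q n] to be a parent of [p n]; the pair is
   sorted accordingly. *)
have [a' [b' [ab' a'n b'n cl]]] : exists a' b', [/\
    (a = a' \/ a = b') /\ (b = a' \/ b = b'), a' < n, b' < n & b' = p a' \/ b' = q a'].
  case: ab => h; [exists a, b | exists a, b | exists b, a | exists b, a];
    by split=> //; auto.
pose p' i := if i == n then a' else p i.
pose q' i := if i == n then b' else q i.
have p'E i : i < n -> (p' i = p i) * (q' i = q i).
  by move=> lt; rewrite /p' /q' (ltn_eqF lt).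
have idxE z : z \notin U -> idx' z = idx z.
  by move=> zU; rewrite /idx' (negPf zU) (contraNF (subsetP SU z) zU).
have idxU z : z \in U -> n <= idx' z.
  by move=> zU; rewrite /idx' zU; case: ifP.
have idxlt z : idx' z < n -> z \notin U.
  by move=> lt; apply/negP => /idxU; rewrite leqNgt lt.
have upE i : i <= n -> upper idx' i = upper idx i.
  move=> le_in; apply/setP => z; rewrite !inE; have [zU|zU] := boolP (z \in U).
    by rewrite (Un _ zU) le_in (leq_trans le_in (idxU _ zU)).
  by rewrite idxE.
have idxS z : idx' z = n -> z \in S.
  rewrite /idx'; case: ifP => // _; case: ifP => [_|/negbT/nU lt E].
    by move/eqP; rewrite (gtn_eqF (ltnSn n)).
  by rewrite E ltnn in lt.
have U'E : upper idx' n.+1 = U :\: S.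
  apply/setP => z; rewrite in_setD [LHS]inE; have [zS|zS] /= := boolP (z \in S).
    by rewrite /idx' zS ltnn.
  rewrite /idx' (negPf zS); have [zU|zU] := boolP (z \in U); first by rewrite ltnSn.
  by have := nU _ zU; lia.
apply: (IH n.+1 idx' pos' p' q').
- rewrite U'E; apply: leq_trans (_ : #|U| <= k); last by rewrite -ltnS.
  rewrite ltnS in cardU; apply: proper_card; rewrite properE subsetDl /=.
  have /set0Pn[s sS] := S0; apply/subsetPn; exists s; first exact: (subsetP SU).
  by rewrite inE sS.
- by move=> z; rewrite /idx'; case: ifP => // _; case: ifP => // _; exact: leqW.
- split.
  + move=> i; rewrite /p' /q'; have [h1 h2] := ppb_parent ppb i.
    by case: ifP => _; split; exact: ltnW.
  + move=> i; have [->|ne] := eqVneq i n.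
      have [-> ->] : p' n = a' /\ q' n = b' by rewrite /p' /q' eqxx.
      by rewrite !(p'E _ a'n).
    have [-> ->] : p' i = p i /\ q' i = q i by rewrite /p' /q' (negPf ne).
    by rewrite !(p'E _ (ppb_parent ppb i).1); exact: ppb_clique ppb i.
  + move=> u w; rewrite ltnS leq_eqVlt => /orP[/eqP En|lt].
      have uS := idxS _ En; rewrite En => /esym/idxS wS.
      by rewrite /pos' uS wS => /dinj; apply.
    have uU := idxlt _ lt; rewrite idxE // => Ew.
    have wU : w \notin U by apply: idxlt; rewrite -Ew -idxE.
    rewrite idxE // in Ew; rewrite /pos' !(contraNF (subsetP SU _)) //.
    by apply: (ppb_inj ppb) => //; rewrite -idxE.
  + move=> u s; rewrite ltnS leq_eqVlt => /orP[/eqP En|lt].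
      have uS := idxS _ En; rewrite En upE // -/U => ps /idxS lS.
      rewrite /pos' lS uS; have uK := subsetP SK _ uS.
      (* The walk never leaves the component [K], where [d] grows by at most one per edge. *)
      elim: s u uK ps {uS En lS} => [|w s IHs] u uK /=; first by rewrite addn0.
      move=> /andP[/and3P[uU wU euw] ps].
      have wK : w \in K by exact: component_step vU uK wU euw.
      by have := IHs _ wK ps; have := dL _ _ uK wK euw; lia.
    have uU := idxlt _ lt; have := lt; rewrite idxE // => lt' ps.
    rewrite upE ?(ltnW lt') // in ps => El.
    have lU : last u s \notin U by apply: idxlt; rewrite El.
    rewrite idxE // in El; rewrite /pos' !(contraNF (subsetP SU _)) //.
    exact: (ppb_isometric ppb).
  + move=> u z z'; rewrite ltnS leq_eqVlt => /orP[/eqP En|lt].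
      have uS := idxS _ En; rewrite En upE // -/U => cuz ezz' /idxlt z'U.
      rewrite idxE // /p' /q' eqxx; have uK := subsetP SK _ uS.
      have zK : z \in K by rewrite inE; rewrite inE in uK; exact: connect_trans cuz.
      have z'K : z' \notin K by apply: contra z'U => /(subsetP KU).
      have [[_ ->]|[_ ->]] := gK.2.2 _ _ zK z'K ezz'; by case: ab'.
    have uU := idxlt _ lt; have := lt; rewrite idxE // => lt'.
    rewrite upE ?(ltnW lt') // => cuz ezz' z'u.
    rewrite !p'E //; rewrite idxE; last by apply: idxlt; exact: ltn_trans z'u lt'.
    apply: (ppb_neighbour ppb lt' cuz ezz').
    by rewrite -(idxE z') //; apply: idxlt; exact: ltn_trans z'u lt'.
move=> w idx_w; have wU' : w \in upper idx' n.+1 by rewrite inE idx_w.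
rewrite U'E in wU' *; have /setDP[wU wS] := wU'.
have idx'K z : z \notin U -> idx' z = idx z by exact: idxE.
have [wK|wK] := boolP (w \in K).
  have CE : component e (U :\: S) w = component e (K :\: S) w.
    have wKS : w \in K :\: S by rewrite inE wS.
    apply/eqP; rewrite eqEsubset; apply/andP; split; last first.
      apply: conn_component; rewrite ?component_refl //.
        exact: component_conn.
      exact: subset_trans (component_sub _ wKS) (setSD _ KU).
    apply: conn_component; rewrite ?component_refl //; first exact: component_conn.
    apply/subsetP => z zC; have := subsetP (component_sub _ wU') _ zC.
    rewrite !in_setD => /andP[-> _] /=; have := wK; rewrite !inE => cvw.
    apply: connect_trans cvw _; rewrite inE in zC.
    by apply: connect_withinS zC; exact: subsetDl.
  have [|z z' zK z'K ezz'||A' [B' [a1 [g a1E]]]] := hS idx' n _ _ w.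
  - by move=> z zS; rewrite /idx' zS.
  - apply: idxE; apply: contra z'K => z'U; exact: component_step vU zK z'U ezz'.
  - by rewrite inE wS.
  exists A', B', a1, n; rewrite CE; split=> //.
    by case: a1E => ->; exact: ltnW.
  have [h1 h2] : p' n = a' /\ q' n = b' by rewrite /p' /q' eqxx.
  rewrite h1 h2; case: ab' => ha hb.
  by case: a1E => ->; [case: ha | case: hb] => ->; try (by constructor 3); constructor 4.
have idx_wn : idx w = n by exact: Un.
have [A1 [B1 [a1 [b1 [g1 a1n b1n ab1]]]]] := gd _ idx_wn.
exists A1, B1, a1, b1; rewrite !p'E //; split=> //; try exact: ltnW.
set K2 := component e U w in g1 *.
have K2U : K2 \subset U by exact: component_sub.
have CE : component e (U :\: S) w = K2.
  apply/eqP; rewrite eqEsubset; apply/andP; split.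
    apply/subsetP => z; rewrite !inE; apply: connect_withinS; exact: subsetDl.
  apply: conn_component; rewrite ?component_refl //; first exact: component_conn.
  rewrite subsetD K2U /=; apply/pred0P => z /=; apply/negP => /andP[zK2 /(subsetP SK) zK].
  by case/negP: wK; rewrite /K -(component_eq e_sym zK) (component_eq e_sym zK2) component_refl.
rewrite CE; case: g1 => h [adj N]; split=> //; split=> // z z' zK z'K ezz'.
rewrite idxE; first exact: N zK z'K ezz'.
by apply: contra z'K => z'U; exact: component_step wU zK z'U ezz'.
Qed.

(** The construction starts at 1: index 0 carries no vertex and serves as default parent, since
    [ppb_parent] demands [p i < n] for every [i]. *)
Lemma path_partition_exists : separable e -> exists m idx pos p q,
  path_partition_below m idx pos p q /\ forall v, idx v < m.
Proof.
move=> sep.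
apply: (@path_partition_extend 1 (fun=> 1) (fun=> 0) (fun=> 0) (fun=> 0)) => //.
  by split=> //; left.
move=> v _; exists set0, set0, 0, 0; split=> //; last by constructor 1.
split; first by split; rewrite -?setI_eq0 ?set0I //; exact: conn0.
split; first by constructor 1.
move=> z z' zC z'C ezz'; case/negP: z'C; apply: component_step zC _ ezz';
  by rewrite inE.
Qed.

End Partition.

(** * The colouring *)

Section Ancestors.
Variables p q : nat -> nat.
Hypothesis clique : forall i, q i = p (p i) \/ q i = q (p i).

Fixpoint ancestors k i : seq nat :=
  i :: if k is k'.+1 then ancestors k' (p i) ++ ancestors k' (q i) else [::].

Lemma ancestors_self k i : i \in ancestors k i.
Proof. by case: k => [|k] /=; rewrite mem_head. Qed.

Lemma ancestors_step k i j : j \in ancestors k i ->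
  {subset [:: j; p j; q j] <= ancestors k.+1 i}.
Proof.
elim: k i => [|k IH] i.
  by rewrite inE => /eqP-> x; rewrite /= !inE.
rewrite [ancestors k.+1 i]/= inE mem_cat => /or3P[/eqP->|h|h] x xj.
- move: xj; rewrite -cat1s -[ancestors _ _]/(i :: (ancestors k.+1 (p i) ++ ancestors k.+1 (q i))).
  by rewrite !inE mem_cat => /or3P[] /eqP->; rewrite ?ancestors_self ?eqxx ?orbT.
- by rewrite -[ancestors _ _]/(i :: (ancestors k.+1 (p i) ++ ancestors k.+1 (q i)))
    inE mem_cat (IH _ h _ xj) orbT.
- by rewrite -[ancestors _ _]/(i :: (ancestors k.+1 (p i) ++ ancestors k.+1 (q i)))
    inE mem_cat (IH _ h _ xj) !orbT.
Qed.

(** A full binary tree would give 1 + 2 + 4 + 8 = 15 indices. As [q i] is itself a parent of [p i],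
    the levels overlap, which leaves 1 + 2 + 3 + 4, the bound binom(r + 2, 2) of treewidth two at r
    = 3. *)
Lemma size_ancestors3 i : size (undup (ancestors 3 i)) <= 10.
Proof.
suff [s ss sub] : exists2 s, size s <= 10 & {subset ancestors 3 i <= s}.
  apply: leq_trans ss; apply: uniq_leq_size (undup_uniq _) _ => x.
  by rewrite mem_undup; exact: sub.
have [E1|E1] := clique i; have [E2|E2] := clique (p i).
- exists [:: i; p i; p (p i); p (p (p i)); q (p (p i)); p (p (p (p i)));
    q (p (p (p i))); p (q (p (p i))); q (q (p (p i)))] => // x.
  rewrite /= E1 E2 !inE; do ?[case: (x == _) => //=].
- exists [:: i; p i; p (p i); p (p (p i)); q (p (p i)); p (p (p (p i)));
    q (p (p (p i))); p (q (p (p i))); q (q (p (p i)))] => // x.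
  rewrite /= E1 E2 !inE; do ?[case: (x == _) => //=].
- exists [:: i; p i; p (p i); p (p (p i)); q (p (p i)); p (p (p (p i)));
    p (p (p (p (p i)))); q (p (p (p (p i)))); p (q (p (p (p i))));
    q (q (p (p (p i))))] => // x.
  rewrite /= E1 E2; have [E3|E3] := clique (p (p (p i)));
    rewrite E3 !inE; do ?[case: (x == _) => //=].
- exists [:: i; p i; p (p i); p (p (p i)); q (p (p i)); p (q (p (p i)));
    p (p (q (p (p i)))); q (p (q (p (p i)))); p (q (q (p (p i))));
    q (q (q (p (p i))))] => // x.
  rewrite /= E1 E2; have [E3|E3] := clique (q (p (p i)));
    rewrite E3 !inE; do ?[case: (x == _) => //=].
Qed.

End Ancestors.

Lemma greedy_colouring (T : finType) (c : rel T) (key : T -> nat) k :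
  symmetric c -> injective key ->
  (forall w, #|[set u | c w u && (key u < key w)]| <= k) ->
  exists col : T -> 'I_k.+1, forall u w, u != w -> c u w -> col u != col w.
Proof.
move=> c_sym key_inj deg.
have partial n : exists col : T -> 'I_k.+1,
    forall u w, key u < n -> key w < n -> u != w -> c u w -> col u != col w.
  elim: n => [|n [col colP]]; first by exists (fun=> ord0).
  have [/existsP[w /eqP wn]|/existsPn no] := boolP [exists w, key w == n]; last first.
    have lt_n u : (key u < n.+1) = (key u < n).
      by rewrite ltnS leq_eqVlt (negPf (no u)).
    by exists col => u w; rewrite !lt_n; exact: colP.
  pose used := col @: [set u | c w u && (key u < key w)].
  have [a aP] : exists a, a \notin used.
    apply/existsP; rewrite -negb_forall; apply/negP => /forallP all.
    have : #|'I_k.+1| <= #|used| by apply: subset_leq_card; apply/subsetP => a _; exact: all.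
    by rewrite card_ord ltnNge (leq_trans (leq_imset_card _ _)).
  have new u : key u < n -> c w u -> col u != a.
    move=> un cwu; apply: contraNneq aP => <-; apply: imset_f.
    by rewrite inE cwu wn.
  have key_w u : (key u < n.+1) = (u == w) || (key u < n).
    by rewrite ltnS leq_eqVlt -wn (inj_eq key_inj).
  exists (fun u => if u == w then a else col u) => u v.
  rewrite !key_w; have [->|uw] /= := eqVneq u w; have [->|vw] /= := eqVneq v w => //.
  - by move=> _ vn _ cwv; rewrite eq_sym new.
  - by move=> un _ _ cuw; rewrite new // c_sym.
  - exact: colP.
have [col colP] := partial (\max_(x : T) key x).+1.
by exists col => u w; apply: colP; rewrite ltnS leq_bigmax.
Qed.

Section Colouring.
Variables (T : finType) (e : rel T).
Hypothesis e_sym : symmetric e.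
Variables (m : nat) (idx pos : T -> nat) (p q : nat -> nat).
Hypothesis pp : path_partition_below e m idx pos p q.
Hypothesis idx_m : forall v, idx v < m.

(** Steps may stand still because a vertex can be its own centre; walks between centres thus have a
    fixed length. *)
Let step (U : {set T}) : rel T := fun x y => [&& x \in U, y \in U & (x == y) || e x y].

Let step_sym U : symmetric (step U).
Proof. by move=> x y; rewrite /step eq_sym e_sym andbCA. Qed.

Lemma lazy_path U u s : path (step U) u s -> exists s',
  [/\ path (within e U) u s', last u s' = last u s & size s' <= size s].
Proof.
elim: s u => [|y s IH] u /=; first by exists [::].
move=> /andP[/and3P[uU yU uy] /IH[s' [ps' ls' ss']]].
have [E|ne] := eqVneq u y; first by exists s'; rewrite E; split=> //; exact: leqW.
exists (y :: s'); split=> //=; rewrite ps' withinE uU yU /=.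
by move: uy; rewrite (negPf ne) /= => ->.
Qed.

Lemma lazy_isometric u s : path (step (upper idx (idx u))) u s ->
  idx (last u s) = idx u -> pos (last u s) <= pos u + size s.
Proof.
move=> /lazy_path[s' [ps' <- ss']] El.
by apply: leq_trans (ppb_isometric pp (idx_m u) ps' El) _; rewrite leq_add2l.
Qed.

Let M := (\max_(v : T) pos v).+1.
Let key v := idx v * M + pos v.

Let posM v : pos v < M. Proof. by rewrite ltnS leq_bigmax. Qed.

Let key_inj : injective key.
Proof.
move=> u v E; apply: (ppb_inj pp (idx_m u)).
  have := congr1 (divn^~ M) E; rewrite /key !divnMDl //.
  by rewrite !divn_small ?posM ?addn0.
by have := congr1 (modn^~ M) E; rewrite /key !modnMDl !modn_small ?posM.
Qed.

Let key_idx u v : key u <= key v -> idx u <= idx v.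
Proof.
move=> h; have := leq_div2r M h; rewrite /key !divnMDl //.
by rewrite !divn_small ?posM ?addn0.
Qed.

Let nbr x y := (x == y) || e x y.

Let nbr_sym : symmetric nbr. Proof. by move=> x y; rewrite /nbr eq_sym e_sym. Qed.

(* Vertices at distance three have disjoint closed neighbourhoods, hence
   distinct centres; a vertex inherits the colour of its centre. *)
Let centre x := [arg min_(v < x | nbr x v) key v].

Let centreP x : nbr x (centre x) /\ forall v, nbr x v -> key (centre x) <= key v.
Proof. by rewrite /centre; case: arg_minnP => [|v h1 h2]; rewrite /nbr ?eqxx. Qed.

(* [z] lies in the component from which the path with index [j] was cut. *)
Let region j z := exists2 v, idx v = j & connect (within e (upper idx j)) v z.

(** If [z'] has index at least [j], the walk is still in the component that the path [j] was cut
    from. Otherwise [z'] is an earlier neighbour of that component and lies on a parent path. The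
    minimum covers both cases. *)
Let region_step j z z' : region j z -> nbr z z' ->
  region (minn j (idx z')) z' /\ minn j (idx z') \in [:: j; p j; q j].
Proof.
move=> [v vj cvz]; have vU : v \in upper idx j by rewrite inE vj.
have zU := connect_within_mem cvz vU.
have [le|lt] := leqP j (idx z').
  move=> zz'; split; last exact: mem_head.
  exists v => //; case/orP: zz' => [/eqP<-//|ezz'].
  by apply: connect_trans cvz (connect1 _); rewrite withinE zU inE le.
case/orP => [/eqP E|ezz']; first by move: zU; rewrite inE leqNgt E lt.
split; first by exists z' => //; exact: connect0.
rewrite -vj in cvz lt *.
by have [->|->] := ppb_neighbour pp (idx_m v) cvz ezz' lt; rewrite !inE eqxx ?orbT.
Qed.

Variable far : rel T.
Hypothesis far_sym : symmetric far.
Hypothesis far_path : forall x y, far x y -> exists a b, [/\ e x a, e a b & e b y].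
Hypothesis far_disjoint : forall x y z, far x y -> nbr x z -> nbr y z -> False.

Let conflict w u := [exists x, exists y, [&& far y x, centre y == w & centre x == u]].

Let conflict_sym : symmetric conflict.
Proof.
by move=> w u; apply/existsP/existsP => -[x /existsP[y /and3P[h1 h2 h3]]];
  exists y; apply/existsP; exists x; rewrite far_sym h1 h2 h3.
Qed.

(* The lazy walk [w y b a x u] joining the two centres. *)
Let conflict_walk w u : conflict w u -> key u < key w -> exists y b a x,
  [/\ path (step (upper idx (idx u))) w [:: y; b; a; x; u]
    & idx u \in ancestors p q 3 (idx w)].
Proof.
case/existsP => x /existsP[y /and3P[yx /eqP yw /eqP xu]] uw.
have [b [a [yb ba ax]]] := far_path yx.
have [nyw minw] := centreP y; have [nxu minu] := centreP x.
rewrite yw in nyw minw; rewrite xu in nxu minu.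
have nyb : nbr y b by rewrite /nbr yb orbT.
have nba : nbr b a by rewrite /nbr ba orbT.
have nax : nbr a x by rewrite /nbr ax orbT.
have nxa : nbr x a by rewrite nbr_sym.
have nwy : nbr w y by rewrite nbr_sym.
(* [y] and [b] are in the closed neighbourhood of [y], where [w] is least; likewise [a] and [x] for
   [u]. *)
have iy : idx w <= idx y by apply/key_idx/minw; rewrite /nbr eqxx.
have ib : idx w <= idx b by apply/key_idx/minw.
have ia : idx u <= idx a by apply/key_idx/minu.
have ix : idx u <= idx x by apply/key_idx/minu; rewrite /nbr eqxx.
have iw : idx u <= idx w by apply/key_idx/ltnW.
exists y, b, a, x; split.
  rewrite /= /step !inE iw ia ix leqnn (leq_trans iw iy) (leq_trans iw ib) /=.
  by rewrite -!/(nbr _ _) nwy nyb nba nax nxu.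
(* Up to [b] the walk stays at index at least [idx w], so only the steps to [a], [x] and [u] can
   reach a parent. *)
have rb : region (idx w) b.
  exists w => //; have wU : w \in upper idx (idx w) by rewrite inE.
  have [s' [ps' ls' _]] : exists s', [/\ path (within e (upper idx (idx w))) w s',
      last w s' = last w [:: y; b] & size s' <= 2].
    by apply: lazy_path; rewrite /= /step !inE leqnn iy ib -!/(nbr _ _) nwy nyb.
  by apply/connectP; exists s'.
have [ra ja] := region_step rb nba.
have [rx jx] := region_step ra nax.
have [ru ju] := region_step rx nxu.
have jE : minn (minn (minn (idx w) (idx a)) (idx x)) (idx u) = idx u.
  by apply/minn_idPr; rewrite !leq_min iw ia ix.
rewrite jE in ju; apply: (ancestors_step _ ju).
apply: (ancestors_step _ jx); apply: (ancestors_step _ ja); exact: ancestors_self.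
Qed.

Let conflict_pos w u : conflict w u -> key u < key w -> idx u = idx w ->
  pos u < pos w <= pos u + 5.
Proof.
move=> cwu lt E; have [y [b [a [x [ps _]]]]] := conflict_walk cwu lt.
move: lt; rewrite /key E ltn_add2l => -> /=.
have := @lazy_isometric u [:: x; a; b; y; w] _ (esym E); apply.
move: ps; rewrite /= ![step _ _ u]step_sym => /and5P[h1 h2 h3 h4 /andP[h5 _]].
by rewrite h5 step_sym h4 step_sym h3 step_sym h2 step_sym h1.
Qed.

(** Both walks of length 5 start at [w] and stay above the common index of [u] and [v]. Reversing
    one and gluing them at [w] gives length 10. *)
Let conflict_pos2 w u v : conflict w u -> key u < key w -> conflict w v ->
  key v < key w -> idx u = idx v -> pos u <= pos v + 10.
Proof.
move=> cwu lu cwv lv E.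
have [y [b [a [x [ps _]]]]] := conflict_walk cwu lu.
have [y' [b' [a' [x' [ps' _]]]]] := conflict_walk cwv lv.
rewrite E in ps.
have := @lazy_isometric v [:: x'; a'; b'; y'; w; y; b; a; x; u] _ E; apply.
rewrite -[[:: _, _, _, _ , _ & _]]/([:: x'; a'; b'; y'; w] ++ [:: y; b; a; x; u]).
rewrite cat_path ps andbT.
move: ps'; rewrite /= ![step _ _ v]step_sym => /and5P[h1 h2 h3 h4 /andP[h5 _]].
by rewrite h5 step_sym h4 step_sym h3 step_sym h2 step_sym h1.
Qed.

Let leq_card_pos (B : {set T}) j h n : {in B, forall u, idx u = j} ->
  {in B, forall u, h <= pos u < h + n} -> #|B| <= n.
Proof.
move=> Bj Bh; case: n => [|n] in Bh *.
  rewrite leqn0 cards_eq0; apply/eqP/setP => u; rewrite inE.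
  by apply/negP => /Bh; rewrite addn0; case: ltngtP.
rewrite -[leqRHS]card_ord -(card_in_imset (f := fun u => inord (pos u - h) : 'I_n.+1)).
  exact: max_card.
move=> u v uB vB /(congr1 val); have hu := Bh _ uB; have hv := Bh _ vB.
rewrite /= !inordK; [|lia|lia] => E.
by apply: (ppb_inj pp (idx_m u)); [rewrite (Bj _ uB) Bj | lia].
Qed.

(* At most 5 centres on the path of [w], and 11 on each of 9 further paths. *)
Let conflict_card w : #|[set u | conflict w u && (key u < key w)]| <= 104.
Proof.
set B := [set u | _]; pose f j := #|[set u in B | idx u == j]|.
have f11 j : f j <= 11.
  rewrite /f; set Bj := [set u in B | _].
  have [->|/set0Pn[u0 u0B]] := eqVneq Bj set0; first by rewrite cards0.
  (* Offsets from the lowest position range over 0 to 10, hence 11. *)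
  case: (arg_minnP pos u0B) => u uB umin.
  apply: (@leq_card_pos _ j (pos u)) => v; first by rewrite inE => /andP[_ /eqP].
  move=> vB; rewrite umin //=.
  have split_B x : x \in Bj -> [/\ conflict w x, key x < key w & idx x = j].
    by rewrite in_set => /andP[+ /eqP]; rewrite in_set => /andP[].
  have [cu lu Eu] := split_B _ uB; have [cv lv Ev] := split_B _ vB.
  by rewrite addnS ltnS; apply: (conflict_pos2 (w := w)); rewrite // Eu.
have f5 : f (idx w) <= 5.
  rewrite /f; apply: (@leq_card_pos _ (idx w) (pos w - 5)) => v;
    rewrite in_set => /andP[+ /eqP E] //; rewrite in_set => /andP[cv lv].
  by have := conflict_pos cv lv E; lia.
set s := undup (ancestors p q 3 (idx w)).
have ws : idx w \in s by rewrite mem_undup ancestors_self.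
have sub : B \subset [set u in B | idx u \in s].
  apply/subsetP => u uB; rewrite inE uB /= mem_undup; move: uB; rewrite inE.
  by case/andP => cu lu; have [y [b [a [x [_]]]]] := conflict_walk cu lu.
apply: leq_trans (subset_leq_card sub) _.
have cover t : #|[set u in B | idx u \in t]| <= \sum_(j <- t) f j.
  elim: t => [|j t IH].
    by rewrite big_nil leqn0 cards_eq0; apply/eqP/setP => u; rewrite !inE andbF.
  rewrite big_cons; apply: leq_trans (leq_add (leqnn _) IH).
  apply: leq_trans (leq_card_setU _ _); apply: subset_leq_card.
  by apply/subsetP => u; rewrite !inE andb_orr.
apply: leq_trans (cover s) _; rewrite (big_rem _ ws) /=.
have : \sum_(j <- rem (idx w) s) f j <= 11 * size (rem (idx w) s).
  elim: (rem _ _) => [|j t IH]; first by rewrite big_nil.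
  by rewrite big_cons /= mulnS leq_add.
rewrite size_rem //; have := size_ancestors3 (ppb_clique pp) (idx w); rewrite -/s.
by move: f5 (size s) (\sum_(j <- rem _ _) f j); generalize (f (idx w)); lia.
Qed.

Lemma far_colouring : exists col : T -> 'I_105, forall x y, far x y -> col x != col y.
Proof.
have [col colP] := greedy_colouring conflict_sym key_inj conflict_card.
exists (fun x => col (centre x)) => x y xy; apply: colP.
  apply/eqP => E; have [h1 _] := centreP x; have [h2 _] := centreP y.
  by apply: (far_disjoint xy h1); rewrite E.
apply/existsP; exists y; apply/existsP; exists x.
by rewrite xy !eqxx.
Qed.

End Colouring.

(** * From drawings to the grid *)

(** Distance at most [r] in the maximum norm, free of truncated subtraction. *)
Definition grid_close (r : nat) (p q : nat * nat) : bool :=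
  [&& p.1 <= q.1 + r, q.1 <= p.1 + r, p.2 <= q.2 + r & q.2 <= p.2 + r].

Lemma grid_closeC r p q : grid_close r p q = grid_close r q p.
Proof. by rewrite /grid_close; lia. Qed.

Lemma grid_close_trans k l p q r : grid_close k p q -> grid_close l q r -> grid_close (k + l) p r.
Proof. by rewrite /grid_close; lia. Qed.

Lemma grid_close_pos p q : 2 <= p.1 -> 2 <= p.2 -> grid_close 1 p q -> (0 < q.1) && (0 < q.2).
Proof. by rewrite /grid_close; lia. Qed.

(* The last exit from [P] before the first entry into [Q]. *)
Lemma path_segment (T : eqType) (e : rel T) (P Q : pred T) x s :
  (forall z, P z -> Q z -> False) -> path e x s -> P x -> Q (last x s) ->
  exists u t v, [/\ P u, Q v, path e u (rcons t v),
    {subset t <= x :: s} & forall z, z \in t -> ~~ P z && ~~ Q z].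
Proof.
move=> PQ ps Px Ql.
suff H y s' : {subset y :: s' <= x :: s} -> path e y s' -> Q (last y s') ->
    P y \/ (exists u t, [/\ P u, path e u (rcons t y), {subset t <= x :: s},
      (forall z, z \in t -> ~~ P z && ~~ Q z) & ~~ P y && ~~ Q y]) ->
    exists u t v, [/\ P u, Q v, path e u (rcons t v),
      {subset t <= x :: s} & forall z, z \in t -> ~~ P z && ~~ Q z].
  by apply: (H x s) => //; left.
elim: s' y => [|z s' IH] y sub /=.
  by move=> _ Qy [/PQ/(_ Qy)//|[u [t [_ _ _ _]]]]; rewrite Qy andbF.
move=> /andP[eyz ps'] Ql' Hy.
have subz : {subset z :: s' <= x :: s}.
  by move=> w ws; apply: sub; rewrite inE ws orbT.
have xy : y \in x :: s by apply: sub; exact: mem_head.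
have [Pz|Pz] := boolP (P z); first by apply: (IH z) => //; left.
have [u [t [Pu pt st nt]]] : exists u t, [/\ P u, path e u (rcons t z),
    {subset t <= x :: s} & forall z, z \in t -> ~~ P z && ~~ Q z].
  case: Hy => [Py|[u [t [Pu pt st nt ny]]]].
    by exists y, [::]; split; rewrite //= eyz.
  exists u, (rcons t y); split=> //.
  - by rewrite rcons_path pt last_rcons.
  - by move=> w; rewrite mem_rcons inE => /orP[/eqP->//|/st].
  - by move=> w; rewrite mem_rcons inE => /orP[/eqP->//|/nt].
have [Qz|Qz] := boolP (Q z); first by exists u, t, z.
by apply: (IH z) => //; right; exists u, t; rewrite Pz Qz.
Qed.

Lemma grid_close_step r p q : grid_close r q p -> p != q -> exists p',
  [/\ grid_adj p p', grid_close r q p'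
    & (p'.1 - q.1) + (q.1 - p'.1) + ((p'.2 - q.2) + (q.2 - p'.2)) <
      (p.1 - q.1) + (q.1 - p.1) + ((p.2 - q.2) + (q.2 - p.2))].
Proof.
case: p q => [a b] [c d]; rewrite /grid_close /grid_adj /= xpair_eqE => h ne.
have [lt|gt|eq] := ltngtP a c.
- by exists (a.+1, b) => /=; split; lia.
- by exists (a.-1, b) => /=; split; lia.
have [lt|gt|eq'] := ltngtP b d.
- by exists (a, b.+1) => /=; split; lia.
- by exists (a, b.-1) => /=; split; lia.
by rewrite eq eq' !eqxx in ne.
Qed.

Lemma grid_close_walk p q : grid_close 1 p q -> exists s,
  [/\ path grid_adj p s, last p s = q & forall t, t \in s -> grid_close 1 q t].
Proof.
case: p q => [a b] [c d] h.
exists ((if a == c then [::] else [:: (c, b)]) ++ (if b == d then [::] else [:: (c, d)])).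
have [Eac|ac] := eqVneq a c; have [Ebd|bd] := eqVneq b d; rewrite ?Eac ?Ebd /=;
  split=> //; rewrite /grid_adj /=; move: h; rewrite /grid_close /=; try lia;
  by move=> h t; rewrite !inE => ht; do ?[case/orP: ht => ht]; move/eqP: ht => -> /=; lia.
Qed.

Section Model.
Variables (V : finType) (e : rel V) (g : V -> nat * nat) (r : nat).
Variable w : V -> V -> seq (nat * nat).
Hypothesis e_sym : symmetric e.
Hypothesis e_irrefl : irreflexive e.
Hypothesis g_ge : forall x, (r < (g x).1) && (r < (g x).2).
Hypothesis w_pos : forall x y (p : nat * nat), e x y -> p \in w x y -> (0 < p.1) && (0 < p.2).
Hypothesis w_path : forall x y, e x y -> path grid_adj (g x) (w x y).
Hypothesis w_last : forall x y, e x y -> last (g x) (w x y) = g y.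
Hypothesis far_vertices : forall x y p, x != y ->
  grid_close r (g x) p -> grid_close r (g y) p -> False.
Hypothesis far_vertex_edge : forall x y z (p : nat * nat), e x y -> z != x -> z != y ->
  p \in w x y -> grid_close r (g z) p -> False.
Hypothesis far_edges : forall x y x' y' (p : nat * nat), e x y -> e x' y' ->
  (x, y) != (x', y') -> (x, y) != (y', x') -> p \in w x y -> p \in w x' y' ->
  ~~ grid_close r (g x) p -> ~~ grid_close r (g y) p -> False.

(** The branch set of [x] is the box of radius [r] around [g x] together with the inner parts,
    between the two boxes, of the walks that [x] owns. Walks of edges with a common end may meet
    near it, which is why [far_edges] speaks of points outside the boxes. *)
Lemma grid_model_separable : separable e.
Proof.
pose N := \max_x \max_y \max_(p <- g x :: w x y) (p.1 + p.2 + r).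
have leN x y (p : nat * nat) : p \in g x :: w x y -> p.1 + p.2 + r <= N.
  move=> pw; apply: leq_trans (leq_bigmax x).
  apply: leq_trans (leq_bigmax y); exact: (@leq_bigmax_seq _ _ xpredT (fun p => p.1 + p.2 + r)).
pose T0 : finType := ('I_N.+1 * 'I_N.+1)%type.
pose c (u : T0) := ((val u.1).+1, (val u.2).+1).
have c_inj : injective c by move=> [a b] [a' b'] [/val_inj-> /val_inj->].
have c_pos u : (0 < (c u).1) && (0 < (c u).2) by [].
pose pt (p : nat * nat) : T0 := (inord p.1.-1, inord p.2.-1).
pose ok (p : nat * nat) := [&& 0 < p.1, 0 < p.2, p.1 <= N & p.2 <= N].
have ptK p : ok p -> c (pt p) = p.
  case: p => a b; rewrite /ok /c /pt /= => h.
  by rewrite !inordK; [congr pair; lia | lia | lia].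
have segP x y : exists t : seq (nat * nat), e x y -> exists u v : nat * nat,
    [/\ grid_close r (g x) u, grid_close r (g y) v, path grid_adj u (rcons t v),
    {subset t <= w x y} & forall z, z \in t -> ~~ grid_close r (g x) z && ~~ grid_close r (g y) z].
  have [exy|_] := boolP (e x y); last by exists [::].
  have refl z : grid_close r (g z) (g z) by rewrite /grid_close; lia.
  have xy : x != y by apply: contraTneq exy => ->; rewrite e_irrefl.
  have [|||u [t [v [Pu Qv pt_ st nt]]]] :=
    @path_segment _ grid_adj (grid_close r (g x)) (grid_close r (g y)) (g x) (w x y) _ (w_path exy).
  - by move=> z; exact: far_vertices xy.
  - exact: refl.
  - by rewrite w_last.
  exists t => _; exists u, v; split=> // z zt; have := st _ zt; rewrite inE.
  by case/orP=> // /eqP E; have := nt _ zt; rewrite E refl.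
have [seg0 seg0P] := fin_all_exists (fun x => fin_all_exists (segP x)).
(* [w x y] and [w y x] are unrelated walks; only the one from the end of smaller rank is used. *)
pose owns x y := e x y && (enum_rank x < enum_rank y).
pose B x p := grid_close r (g x) p || [exists y, owns x y && (p \in seg0 x y)].
have BP x p : B x p -> grid_close r (g x) p \/ exists2 y, owns x y & p \in seg0 x y.
  by case/orP=> [|/existsP[y /andP[h1 h2]]]; [left | right; exists y].
have seg_w x y p : e x y -> p \in seg0 x y ->
    [/\ p \in w x y, ~~ grid_close r (g x) p & ~~ grid_close r (g y) p].
  move=> exy pt0; have [u [v [_ _ _ st nt]]] := seg0P x y exy.
  by have /andP[] := nt _ pt0; split=> //; exact: st.
have Bok x p : B x p -> ok p.
  case/BP => [|[y /andP[exy _] /(seg_w _ _ _ exy)[pw _ _]]].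
    have := leN x x (g x) (mem_head _ _); have := g_ge x; rewrite /grid_close /ok; lia.
  have := leN x y p; rewrite inE pw orbT => /(_ isT).
  have := w_pos exy pw; rewrite /ok; lia.
pose b x := [set u : T0 | B x (c u)].
have inb x p : B x p -> pt p \in b x by move=> Bp; rewrite inE ptK ?(Bok x).
have within_step x p p' : B x p -> B x p' -> grid_adj p p' ->
    within (grid_rel c) (b x) (pt p) (pt p').
  by move=> Bp Bp' pp'; rewrite withinE !inb //= /grid_rel !ptK ?(Bok x).
have grid_sym : symmetric (grid_rel c) by move=> u v; exact: grid_adj_sym.
have cs x := connect_within_sym grid_sym (b x).
have gB x : B x (g x) by rewrite /B /grid_close; apply/orP; left; lia.
have box_conn x p : grid_close r (g x) p -> connect (within (grid_rel c) (b x)) (pt (g x)) (pt p).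
  pose D (p : nat * nat) := (p.1 - (g x).1) + ((g x).1 - p.1) + ((p.2 - (g x).2) + ((g x).2 - p.2)).
  have [n] := ubnP (D p); elim: n p => // n IH p; rewrite ltnS => Dp cp.
  have [->|ne] := eqVneq p (g x); first exact: connect0.
  have [p' [pp' cp' Dp']] := grid_close_step cp ne.
  apply: connect_trans (IH p' (leq_trans Dp' Dp) cp') (connect1 _).
  by apply: within_step; rewrite ?/B ?cp ?cp' // grid_adj_sym.
have seg_path x y t : owns x y -> {subset t <= seg0 x y} -> forall u, B x u ->
    path grid_adj u t -> connect (within (grid_rel c) (b x)) (pt u) (pt (last u t)).
  move=> oxy; elim: t => [|p t IH] sub u Bu /=; first by move=> _; exact: connect0.
  move=> /andP[up pp]; have Bp : B x p.
    by apply/orP; right; apply/existsP; exists y; rewrite oxy sub ?mem_head.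
  apply: connect_trans (connect1 (within_step _ _ _ Bu Bp up)) _.
  by apply: IH => // q qt; apply: sub; rewrite inE qt orbT.
apply: (@minor_separable _ _ _ (grid_rel c) b) => //.
- by move=> x; apply/set0Pn; exists (pt (g x)); exact: inb.
- move=> x; apply: (conn_root grid_sym (r := pt (g x))) => u; rewrite inE => Bu.
  have -> : u = pt (c u) by apply: c_inj; rewrite ptK ?(Bok x).
  case/BP: (Bu) => [/box_conn//|[y oxy]].
  have [exy _] := andP oxy; have [u0 [v0 [cu0 cv0 p0 st nt]]] := seg0P x y exy.
  move=> pseg; have := p0; case/splitPr: pseg (seg_path x y) => t1 t2.
  rewrite -cat_rcons rcons_cat cat_path => sp /andP[p1 _].
  have /sp := oxy => /(_ (rcons t1 (c u))).
  have sub1 : {subset rcons t1 (c u) <= rcons t1 (c u) ++ t2}.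
    by move=> z; rewrite mem_cat => ->.
  have Bu0 : B x u0 by rewrite /B cu0.
  move=> /(_ sub1 u0 Bu0 p1); rewrite last_rcons.
  exact: connect_trans (box_conn _ _ cu0).
- move=> x y xy; apply/pred0P => u /=; apply/negP; rewrite !inE => /andP[Bx By].
  case/BP: Bx => [cx|[x' /andP[exx' rx] pxx']]; case/BP: By => [cy|[y' /andP[eyy' ry] pyy']].
  + exact: far_vertices xy cx cy.
  + have [pw n1 n2] := seg_w _ _ _ eyy' pyy'.
    apply: (far_vertex_edge eyy' xy _ pw cx).
    by apply: contraNneq n2 => <-.
  + have [pw n1 n2] := seg_w _ _ _ exx' pxx'.
    apply: (far_vertex_edge exx' _ _ pw cy); first by rewrite eq_sym.
    by apply: contraNneq n2 => <-.
  + have [pw n1 n2] := seg_w _ _ _ exx' pxx'; have [pw' _ _] := seg_w _ _ _ eyy' pyy'.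
    apply: (far_edges exx' eyy' _ _ pw pw' n1 n2); rewrite xpair_eqE ?(negPf xy) //.
    apply/negP => /andP[/eqP E1 /eqP E2]; rewrite -E1 -E2 in ry.
    by move: ry; rewrite ltnNge (ltnW rx).
- move=> x y exy; wlog rxy : x y exy / enum_rank x < enum_rank y => [h|].
    have [|lt|E] := ltngtP (enum_rank x) (enum_rank y); first exact: h.
      by rewrite (adjacent_sym grid_sym) h // e_sym.
    by rewrite (enum_rank_inj (val_inj E)) e_irrefl in exy.
  have oxy : owns x y by rewrite /owns exy.
  have [u0 [v0 [cu0 cv0 p0 st nt]]] := seg0P x y exy.
  have Bt z : z \in seg0 x y -> B x z.
    by move=> zs; apply/orP; right; apply/existsP; exists y; rewrite oxy.
  have Bl : B x (last u0 (seg0 x y)).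
    have := mem_last u0 (seg0 x y); rewrite inE => /orP[/eqP->|/Bt//].
    by rewrite /B cu0.
  move: p0; rewrite rcons_path => /andP[_ lv].
  have Bv : B y v0 by rewrite /B cv0.
  apply/adjacentP; exists (pt (last u0 (seg0 x y))), (pt v0).
  by rewrite !inb // /grid_rel !ptK ?(Bok _ _ Bv) ?(Bok _ _ Bl).
exact: grid_separable.
Qed.

End Model.

(* Imported only now, because [classical_sets] shadows the names of [finset]. *)
From mathcomp Require Import all_order all_algebra ssrZ.
From mathcomp Require Import all_classical all_reals all_analysis ring lra.

Import Order.TTheory GRing.Theory Num.Theory.
Import numFieldNormedType.Exports.

(** * Discretising the arcs of a drawing *)

Section Drawing.
Local Open Scope classical_set_scope.
Local Open Scope ring_scope.
Variable R : realType.
Implicit Types (A B : set (R * R)) (z : R * R).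

Lemma ball_pair z e z' :
  ball z e z' <-> `|z.1 - z'.1| < e /\ `|z.2 - z'.2| < e.
Proof. by rewrite /ball /= /prod_ball -!ball_normE. Qed.

Lemma compact_gap A B : compact A -> closed B -> A `&` B = set0 ->
  exists2 d : R, 0 < d & forall z z', A z -> B z' -> ~ ball z d z'.
Proof.
move=> /compact_near_coveringP cA cB AB.
have gap : \forall d \near (0 : R)^'+, A `<=` (fun z => forall z', B z' -> ~ ball z d z').
  apply: (cA R (0 : R)^'+ (fun d z => forall z', B z' -> ~ ball z d z')) => z Az.
  have nBz : (~` B) z by move=> Bz; have : set0 z by rewrite -AB.
  have /nbhs_ballP[e /= e0 eB] : nbhs z (~` B).
    by apply: open_nbhs_nbhs; split=> //; exact: closed_openC.
  near=> z' d.
  have zz' : ball z (e / 2) z' by near: z'; apply: nbhsx_ballx; rewrite divr_gt0.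
  have de : d <= e / 2 by near: d; apply: nbhs_right_le; rewrite divr_gt0.
  move=> w Bw zdw; apply: (eB w) => //.
  rewrite [e]splitr; apply: ball_triangle zz' _; exact: le_ball zdw.
near (0 : R)^'+ => d; exists d => [//|].
suff h : A `<=` (fun z => forall z', B z' -> ~ ball z d z') by move=> z z' /h; apply.
by near: d.
Unshelve. all: by end_near. Qed.

Lemma finite_gap (I : finType) (P : I -> R -> Prop) :
  (forall i, exists2 d, 0 < d & P i d) ->
  (forall i d d', 0 < d' -> d' <= d -> P i d -> P i d') ->
  exists2 d, 0 < d & forall i, P i d.
Proof.
move=> ex mono; have ex' i : exists d, 0 < d /\ P i d by have [d d0 Pd] := ex i; exists d.
(* The inverse of a sum of inverses lies below every [d i]; the summand 1 keeps it positive when [I]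
   is empty. *)
have [d dP] := fin_all_exists ex'; pose s := 1 + \sum_i (d i)^-1.
have s0 : 0 < s.
  by rewrite ltr_pwDl // sumr_ge0 // => i _; rewrite invr_ge0 ltW //; have [] := dP i.
exists s^-1; first by rewrite invr_gt0.
move=> i; have [d0 Pd] := dP i; apply: mono Pd; first by rewrite invr_gt0.
rewrite -[leRHS]invrK lef_pV2 ?posrE ?invr_gt0 // /s (bigD1 i) //= addrA addrAC.
rewrite addrC lerDl addr_ge0 // sumr_ge0 // => j _.
by rewrite invr_ge0 ltW //; have [] := dP j.
Qed.

Section Discretisation.
Variables (b e : R).
Hypothesis e_gt0 : 0 < e.

(** [e] is the mesh; the shift by [b] makes coordinates non-negative, where truncation is the
    floor. *)
Definition cell z : nat * nat :=
  (Num.truncn ((z.1 + b) / e), Num.truncn ((z.2 + b) / e)).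

Lemma truncn_close (s t : R) (k : nat) : 0 <= s -> 0 <= t -> `|s - t| < k%:R ->
  (Num.truncn s <= Num.truncn t + k)%N.
Proof.
move=> s0 t0 h; have /andP[s1 s2] := truncn_itv s0; have /andP[t1 t2] := truncn_itv t0.
rewrite -ltnS -(ltr_nat R) -addSn natrD.
apply: le_lt_trans s1 _; have := ler_norm (s - t); lra.
Qed.

Lemma truncn_far (s t : R) (k : nat) : 0 <= s -> 0 <= t ->
  (Num.truncn s <= Num.truncn t + k)%N -> s - t < k.+1%:R.
Proof.
move=> s0 t0 h; have /andP[s1 s2] := truncn_itv s0; have /andP[t1 t2] := truncn_itv t0.
have : (Num.truncn s).+1%:R <= (Num.truncn t)%:R + k.+1%:R :> R.
  by rewrite -natrD ler_nat addnS ltnS.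
by lra.
Qed.

Lemma ball_cell (k : nat) z z' : 0 <= z.1 + b -> 0 <= z.2 + b ->
  0 <= z'.1 + b -> 0 <= z'.2 + b ->
  ball z (k%:R * e) z' -> grid_close k (cell z) (cell z').
Proof.
move=> h1 h2 h3 h4 /ball_pair[d1 d2].
have scale (s t : R) : `|s - t| < k%:R * e -> `|(s + b) / e - (t + b) / e| < k%:R.
  move=> st; rewrite -mulrBl normrM [`|e^-1|]gtr0_norm ?invr_gt0 // ltr_pdivrMr //.
  by rewrite opprD addrACA subrr addr0.
have h (s : R) : 0 <= s + b -> 0 <= (s + b) / e by move=> ?; rewrite divr_ge0 // ltW.
rewrite /grid_close /cell /=; apply/and4P; split; apply: truncn_close; rewrite ?h // scale //.
  by rewrite distrC.
by rewrite distrC.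
Qed.

Lemma cell_ball (k : nat) z z' : 0 <= z.1 + b -> 0 <= z.2 + b ->
  0 <= z'.1 + b -> 0 <= z'.2 + b ->
  grid_close k (cell z) (cell z') -> ball z (k.+1%:R * e) z'.
Proof.
move=> h1 h2 h3 h4 /and4P[d1 d2 d3 d4].
have h (s : R) : 0 <= s + b -> 0 <= (s + b) / e by move=> ?; rewrite divr_ge0 // ltW.
have scale (s t : R) : (s + b) / e - (t + b) / e < k.+1%:R -> s - t < k.+1%:R * e.
  by rewrite -mulrBl ltr_pdivrMr // opprD addrACA subrr addr0.
have norm_lt (s t : R) : s - t < k.+1%:R * e -> t - s < k.+1%:R * e ->
    `|s - t| < k.+1%:R * e by move=> ? ?; rewrite ltr_norml ltrNl opprB; apply/andP.
by apply/ball_pair; split; apply: norm_lt; apply: scale; apply: truncn_far; rewrite ?h.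
Qed.

(** The points of [A] whose cells can be reached form a relatively open and closed set, because
    points less than [e] apart have cells that differ by at most one in each coordinate. *)
Lemma connected_walk A z z' : connected A ->
  (forall z, A z -> 0 <= z.1 + b /\ 0 <= z.2 + b) -> A z -> A z' ->
  exists s, [/\ path grid_adj (cell z) s, last (cell z) s = cell z' &
    forall t, t \in s -> exists2 w, A w & grid_close 1 (cell w) t].
Proof.
move=> cA pos Az Az'.
pose W w := exists s, [/\ path grid_adj (cell z) s, last (cell z) s = cell w &
    forall t, t \in s -> exists2 w, A w & grid_close 1 (cell w) t].
have W_step w w' : A w -> A w' -> ball w e w' -> W w -> W w'.
  move=> Aw Aw' ww' [s [ps ls ns]].
  have [p1 p2] := pos _ Aw; have [p3 p4] := pos _ Aw'.
  have /grid_close_walk[s' [ps' ls' ns']] : grid_close 1 (cell w) (cell w').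
    by apply: ball_cell => //; rewrite mul1r.
  exists (s ++ s'); rewrite cat_path ps ls ps' last_cat ls ls'; split=> // t.
  by rewrite mem_cat => /orP[/ns//|/ns' h]; exists w'.
suff : A `&` W = A by move=> AW; have [] : (A `&` W) z' by rewrite AW.
apply: cA.
- exists z; split=> //; exists [::]; split=> // t; by rewrite inE.
- exists (\bigcup_(w in A `&` W) ball w e).
    by apply: bigcup_open => w _; exact: ball_open.
  apply/seteqP; split=> w [Aw].
    by move=> Ww; split=> //; exists w => //; exact: ballxx.
  by move=> [w' [Aw' Ww'] w'w]; split=> //; exact: W_step w'w Ww'.
- exists (~` (\bigcup_(w in A `\` W) ball w e)).
    by apply: open_closedC; apply: bigcup_open => w _; exact: ball_open.
  apply/seteqP; split=> w [Aw].
    move=> Ww; split=> // -[w' [Aw' nW] w'w]; apply: nW.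
    by apply: W_step Ww => //; exact: ball_sym.
  move=> h; split=> //; apply: contrapT => nW; apply: h.
  by exists w => //; exact: ballxx.
Qed.

End Discretisation.
Lemma arc_props (p q : R * R) (A : set (R * R)) :
  arc_between p q A -> [/\ compact A, connected A, A p & A q].
Proof.
move=> [f [fc _ f0 f1 ->]]; split.
- exact: continuous_compact fc (@segment_compact _ 0 1).
- exact: connected_continuous_connected (@segment_connected _ 0 1) fc.
- by exists 0 => //=; rewrite in_itv /= lexx ler01.
- by exists 1 => //=; rewrite in_itv /= lexx ler01.
Qed.

(** Compactness gives positive gaps between vertices, between a vertex and an arc not ending there,
    and between two arcs away from the ends of the first. A mesh fine enough against all three
    carries them over to the grid. *)
Theorem planar_separable (G : sgraph) :
  planar R G -> separable (@edge G).
Proof.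
move=> [v [A [v_inj arcs _ int_v int_A]]].
have arcP x y : edge x y -> [/\ compact (A x y), connected (A x y), A x y (v x) & A x y (v y)].
  by move=> /arcs/arc_props.
have haus : hausdorff_space (R * R)%type := @norm_hausdorff _ _.
have closed_pt z : closed [set z : R * R] by apply: compact_closed => //; exact: compact_set1.
have [d1 d10 gap1] : exists2 d : R, 0 < d &
    forall i : G * G, i.1 != i.2 -> ~ ball (v i.1) d (v i.2).
  apply: finite_gap => [[x y]|[x y] d d' _ dd' h xy /= bd]; last first.
    by apply: (h xy) => /=; exact: le_ball dd' _ bd.
  have [->|xy] := eqVneq x y; first by exists 1 => //=; rewrite eqxx.
  have [|d d0 h] := compact_gap (@compact_set1 _ (v x)) (closed_pt (v y)).
    apply/seteqP; split=> // z [/= -> /v_inj E]; by rewrite E eqxx in xy.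
  by exists d => // _; exact: h.
have [d2 d20 gap2] : exists2 d : R, 0 < d &
    forall i : G * G * G, edge i.1.1 i.1.2 -> i.2 != i.1.1 -> i.2 != i.1.2 ->
      forall w, A i.1.1 i.1.2 w -> ~ ball (v i.2) d w.
  apply: finite_gap => [[[x y] z]|[[x y] z] d d' _ dd' h /= exy zx zy w Aw bd]; last first.
    by apply: (h exy zx zy w Aw) => /=; exact: le_ball dd' _ bd.
  have [/andP[exy /andP[zx zy]]|no] := boolP [&& edge x y, z != x & z != y]; last first.
    by exists 1 => //= exy zx zy; rewrite exy zx zy in no.
  have [cA _ _ _] := arcP _ _ exy.
  have [|d d0 h] := compact_gap (@compact_set1 _ (v z)) (compact_closed haus cA).
    apply/seteqP; split=> // _ [/= -> Az].
    suff : set0 (v z) by []; rewrite -(int_v _ _ exy); split; last by exists z.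
    by split=> // -[/v_inj|/v_inj] E; [rewrite E eqxx in zx | rewrite E eqxx in zy].
  by exists d => //= _ _ _ w Aw; exact: h.
(* If the boxes of two vertices met, the vertices would be less than 2 * [rho] + 3 * [e] apart,
   which is at most 3 * [rho]. *)
pose rho := Num.min d1 d2 / 3.
have rho0 : 0 < rho by rewrite divr_gt0 // lt_min d10.
have rho1 : 3 * rho <= d1 by rewrite /rho mulrC divfK // ge_min lexx.
have rho2 : 3 * rho <= d2 by rewrite /rho mulrC divfK // ge_min lexx orbT.
(* Away from the ends, distinct arcs are a positive distance apart. *)
pose mid x y := A x y `&` (~` ball (v x) rho `&` ~` ball (v y) rho).
have [d3 d30 gap3] : exists2 d : R, 0 < d &
    forall i : (G * G) * (G * G), edge i.1.1 i.1.2 -> edge i.2.1 i.2.2 ->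
      (i.1.1, i.1.2) != (i.2.1, i.2.2) -> (i.1.1, i.1.2) != (i.2.2, i.2.1) ->
      forall z z', mid i.1.1 i.1.2 z -> A i.2.1 i.2.2 z' -> ~ ball z d z'.
  apply: finite_gap => [[[x y] [x' y']]|i d d' _ dd' h e1 e2 n1 n2 z z' mz Az bd]; last first.
    by apply: (h e1 e2 n1 n2 z z' mz Az); exact: le_ball dd' _ bd.
  have [/and4P[exy exy' n1 n2]|no] :=
    boolP [&& edge x y, edge x' y', (x, y) != (x', y') & (x, y) != (y', x')]; last first.
    by exists 1 => //= h1 h2 h3 h4; rewrite h1 h2 h3 h4 in no.
  have [cA _ _ _] := arcP _ _ exy; have [cA' _ _ _] := arcP _ _ exy'.
  have cm : compact (mid x y).
    apply: compact_closedI => //.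
    by apply: closedI; apply: open_closedC; exact: ball_open.
  have [|d d0 h] := compact_gap cm (compact_closed haus cA').
    apply/seteqP; split=> // z [[Az [nx ny]] Az'].
    suff : set0 z by []; rewrite -(int_A _ _ _ _ exy exy' _); first split=> //.
      by split=> // -[] /= E; [apply: nx | apply: ny]; rewrite E; exact: ballxx.
    have nxy : x <> y by move=> E; rewrite E edge_irrefl in exy.
    move=> E; have hx : [set x'; y'] x by rewrite -E; left.
    have hy : [set x'; y'] y by rewrite -E; right.
    case: hx => /= hx; case: hy => /= hy; rewrite ?hx ?hy in nxy n1 n2 *; try by [].
      by rewrite eqxx in n1.
    by rewrite eqxx in n2.
  by exists d => //= _ _ _ _; exact: h.
(* A bound written as the inverse of a gap is made uniform by [finite_gap] too. *)
have [bi bi0 bound] : exists2 d : R, 0 < d & forall i : G * G,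
    `|v i.1| <= d^-1 /\ (edge i.1 i.2 -> forall z, A i.1 i.2 z -> `|z| <= d^-1).
  apply: finite_gap => [[x y]|i d d' d'0 dd' [h1 h2]]; last first.
    have dV : d^-1 <= d'^-1 by rewrite lef_pV2 ?posrE // (lt_le_trans d'0).
    split=> [|e1 z Az]; first exact: le_trans h1 dV.
    exact: le_trans (h2 e1 z Az) dV.
  have [M M0 MA] : exists2 M : R, 0 < M & edge x y -> forall z, A x y z -> `|z| <= M.
    have [exy|nxy] := boolP (edge x y); last by exists 1.
    have [cA _ _ _] := arcP _ _ exy.
    have [M M0 h] := pinfty_ex_gt0 (compact_bounded cA).
    by exists M => // _ z Az; exact: h.
  have M1 : 0 < M + `|v x| by rewrite ltr_wpDr.
  exists (M + `|v x|)^-1; rewrite ?invr_gt0 // invrK; split=> [|exy z Az].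
    by rewrite lerDr ltW.
  by rewrite (le_trans (MA exy z Az)) // lerDl.
(* The truncation yields 3 * [e] <= [d3], as arc points whose walks share a cell are less than 3 *
   [e] apart. The 4 yields 4 * [e] <= [rho]. *)
pose m := (Num.truncn (3 * rho / d3)).+4.
pose e := rho / m%:R.
have m0 : 0 < m%:R :> R by rewrite ltr0n.
have e0 : 0 < e by rewrite divr_gt0.
have me : m%:R * e = rho by rewrite /e mulrC divfK // gt_eqF.
have e3 : 3 * e <= d3.
  have h : 3 * rho / d3 <= m%:R.
    apply: ltW; apply: lt_le_trans (truncnS_gt _) _; by rewrite ler_nat /m ltnS !leqW.
  by rewrite /e mulrA ler_pdivrMr // -ler_pdivrMl // mulrC.
have m4 : 4 <= m%:R :> R by rewrite (ler_nat _ 4).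
have e4 : 4 * e <= rho by rewrite -me ler_pM2r.
clearbody e; clearbody m.
(* The margin 2 * [rho] exceeds m + 2 meshes, so boxes of radius m + 1 keep positive coordinates. *)
pose b := bi^-1 + 2 * rho.
have pos z : `|z| <= bi^-1 -> 2 * rho <= z.1 + b /\ 2 * rho <= z.2 + b.
  rewrite prod_normE ge_max !ler_norml => /andP[/andP[h1 _] /andP[h2 _]].
  by rewrite /b; split; lra.
have posv x : 2 * rho <= (v x).1 + b /\ 2 * rho <= (v x).2 + b.
  by have [/pos] := bound (x, x).
have posA x y z : edge x y -> A x y z -> 2 * rho <= z.1 + b /\ 2 * rho <= z.2 + b.
  by move=> exy Az; have [_ /(_ exy z Az)/pos] := bound (x, y).
have ge0 s : 2 * rho <= s -> 0 <= s by lra.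
have cell_ge z : 2 * rho <= z.1 + b /\ 2 * rho <= z.2 + b ->
    (m.+2 <= (cell b e z).1)%N /\ (m.+2 <= (cell b e z).2)%N.
  have h s : 2 * rho <= s -> m.+2%:R <= s / e.
    move=> hs; rewrite ler_pdivlMr // -addn2 natrD mulrDl me; lra.
  have h0 s : 2 * rho <= s -> 0 <= s / e by move=> /ge0 s0; rewrite divr_ge0 // ltW.
  by move=> [h1 h2]; rewrite /cell /=; split; rewrite truncn_ge_nat; auto.
have walks x y : exists s, edge x y -> [/\ path grid_adj (cell b e (v x)) s,
    last (cell b e (v x)) s = cell b e (v y) &
    forall t, t \in s -> exists2 w, A x y w & grid_close 1 (cell b e w) t].
  have [exy|nxy] := boolP (edge x y); last by exists [::].
  have [_ cA Ax Ay] := arcP _ _ exy.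
  have [|s hs] := connected_walk (b := b) e0 cA _ Ax Ay; last by exists s.
  by move=> z /(posA _ _ _ exy)[h1 h2]; split; exact: ge0.
have [w wP] := fin_all_exists (fun x => fin_all_exists (walks x)).
have wnear x y t : edge x y -> t \in w x y -> exists2 u, A x y u & grid_close 1 (cell b e u) t.
  by move=> /(wP x y)[_ _]; apply.
have near_ball k z z' : 2 * rho <= z.1 + b /\ 2 * rho <= z.2 + b ->
    2 * rho <= z'.1 + b /\ 2 * rho <= z'.2 + b ->
    grid_close k (cell b e z) (cell b e z') -> ball z (k.+1%:R * e) z'.
  move=> [h1 h2] [h3 h4] hc; apply: cell_ball hc => //; exact: ge0.
(* A point within [rho] of a vertex has its cell within [m], and a walk is within one cell of its
   arc. So a walk point outside the boxes of radius m + 1 comes from an arc point in [mid]. *)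
apply: (@grid_model_separable _ _ (fun x => cell b e (v x)) m.+1 w).
- exact: edge_sym.
- exact: edge_irrefl.
- by move=> x; have [h1 h2] := cell_ge _ (posv x); apply/andP.
- move=> x y p exy /(wnear _ _ _ exy)[z Az].
  have [h1 h2] := cell_ge _ (posA _ _ _ exy Az).
  by apply: grid_close_pos; [exact: leq_trans h1 | exact: leq_trans h2].
- by move=> x y /(wP x y)[].
- by move=> x y /(wP x y)[].
- move=> x y p xy cx cy; apply: (gap1 (x, y) xy) => /=.
  have /(near_ball _ _ _ (posv x) (posv y)) :
      grid_close (m.+1 + m.+1) (cell b e (v x)) (cell b e (v y)).
    by apply: grid_close_trans cx _; rewrite grid_closeC.
  apply: le_ball; apply: le_trans rho1.
  have -> : (m.+1 + m.+1).+1%:R = m%:R + m%:R + 3%:R :> R by rewrite -!natrD addSn addnS addn3.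
  by rewrite !mulrDl me; lra.
- move=> x y z p exy zx zy /(wnear _ _ _ exy)[u Au cu] cz.
  apply: (gap2 (x, y, z) exy zx zy u Au) => /=.
  have /(near_ball _ _ _ (posv z) (posA _ _ _ exy Au)) :
      grid_close m.+2 (cell b e (v z)) (cell b e u).
    by rewrite -[m.+2]addn1; apply: grid_close_trans cz _; rewrite grid_closeC.
  apply: le_ball; apply: le_trans rho2.
  have -> : m.+3%:R = m%:R + 3%:R :> R by rewrite -!natrD addn3.
  by rewrite !mulrDl me; lra.
- move=> x y x' y' p exy exy' n1 n2.
  move=> /(wnear _ _ _ exy)[z Az cz] /(wnear _ _ _ exy')[z' Az' cz'] nx ny.
  have zpos := posA _ _ _ exy Az; have z'pos := posA _ _ _ exy' Az'.
  have nball u : 2 * rho <= (v u).1 + b /\ 2 * rho <= (v u).2 + b ->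
      ~~ grid_close m.+1 (cell b e (v u)) p -> ~ ball (v u) rho z.
    move=> [h1 h2] /negP + bz; apply; have [h3 h4] := zpos.
    have : grid_close m (cell b e (v u)) (cell b e z).
      by apply: ball_cell; rewrite ?me // ge0.
    by move=> /grid_close_trans/(_ cz); rewrite addn1.
  apply: (gap3 ((x, y), (x', y')) exy exy' n1 n2 z z') => //.
    by split=> //; split; [exact: nball (posv x) nx | exact: nball (posv y) ny].
  have /(near_ball _ _ _ zpos z'pos) : grid_close 2 (cell b e z) (cell b e z').
    by rewrite -[2%N]/(1 + 1)%N; apply: grid_close_trans cz _; rewrite grid_closeC.
  exact: le_ball.
Qed.

End Drawing.

(** * The upper bound *)

Section Distance.
Variable G : sgraph.
Implicit Types x y z : G.

Lemma edge_neq x y : edge x y -> x != y.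
Proof. by apply: contraTneq => ->; rewrite edge_irrefl. Qed.

Lemma path_of_length2 x z y : x != y -> edge x z -> edge z y -> path_of_length 2 x y.
Proof.
move=> xy xz zy; apply/existsP; exists [tuple z; y].
by rewrite /= xz zy eqxx !inE negb_or xy (edge_neq xz) (edge_neq zy).
Qed.

(** [path_of_length] asks for simple paths; a walk of length 3 between vertices at no smaller
    distance is automatically simple. *)
Lemma at_distance3P x y : at_distance 3 x y <->
  (exists a b, [/\ edge x a, edge a b & edge b y]) /\
  [/\ x != y, ~~ edge x y & forall z, edge x z -> ~~ edge z y].
Proof.
split.
  case/andP => /existsP[[[|a [|b [|c [|//]]]] // sz]] /= /and3P[/and4P[xa ab bc _] us /eqP cy].
  move=> /forallP no; rewrite cy in bc.
  have xy : x != y by move: us; rewrite cy !inE !negb_or => /andP[/and3P[]].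
  split; first by exists a, b.
  split=> //.
    apply/negP => exy; have /negP := no (Ordinal (isT : 1 < 3)); apply.
    by apply/existsP; exists [tuple y]; rewrite /= exy inE xy eqxx.
  move=> z xz; apply/negP => zy; have /negP := no (Ordinal (isT : 2 < 3)); apply.
  exact: path_of_length2 zy.
move=> [[a [b [xa ab by_]]] [xy nxy no]]; apply/andP; split.
  apply/existsP; exists [tuple a; b; y]; rewrite /= xa ab by_ eqxx andbT /=.
  rewrite !inE !negb_or xy.
  rewrite (edge_neq xa) (edge_neq ab) (edge_neq by_) /= !andbT; apply/andP; split.
    by apply: contraNneq nxy => ->.
  by apply: contraNneq nxy => <-.
apply/forallP => -[[|[|[|//]]] lt]; apply/negP => /existsP[[s /= sz]].
- by case: s sz => //= _; rewrite (negPf xy).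
- case: s sz => [|u [|//]] //= _ /and3P[/andP[xu _] _ /eqP uy].
  by rewrite uy (negPf nxy) in xu.
case: s sz => [|u [|w [|//]]] //= _ /and3P[/and3P[xu uw _] _ /eqP wy].
by have := no _ xu; rewrite -wy uw.
Qed.

End Distance.

Lemma chromatic_number_le (G : sgraph) k : colourable G k -> chromatic_number G <= k.
Proof. by rewrite /chromatic_number; case: ex_minnP => m _; apply. Qed.

Lemma colourableP (G : sgraph) k :
  reflect (exists c : G -> 'I_k, forall x y, edge x y -> c x != c y) (colourable G k).
Proof.
apply: (iffP existsP) => [[c /forallP h]|[c h]].
  by exists c => x y exy; have /forallP/(_ y)/implyP/(_ exy) := h x.
exists [ffun x => c x]; apply/forallP => x; apply/forallP => y.
by apply/implyP => /h; rewrite !ffunE.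
Qed.

Lemma planar_exact_distance3 (R : realType) (G : sgraph) : planar R G ->
  chromatic_number (exact_distance_graph G 3 isT) <= 105.
Proof.
move=> /planar_separable sep; apply: chromatic_number_le.
have e_sym := @edge_sym G.
have [m [idx [pos [p [q [pp idx_m]]]]]] := path_partition_exists e_sym sep.
have [||x y z xy|c hc] := @far_colouring _ _ e_sym _ _ _ _ _ pp idx_m (at_distance 3).
- exact: at_distance_sym.
- by move=> x y /at_distance3P[].
- move/at_distance3P: xy => [_ [xy nxy no]].
  case/orP => [/eqP<-|xz]; case/orP => [/eqP yz|yz].
  + by rewrite yz eqxx in xy.
  + by rewrite e_sym yz in nxy.
  + by rewrite yz xz in nxy.
  + by have := no _ xz; rewrite e_sym yz.
by apply/colourableP; exists c.
Qed.

(** * A planar graph that needs seven colours *)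

(** Twice the signed area of the triangle. The ring is general so that signs computed over binary
    integers transfer to the reals. *)
Definition orient (K : comPzRingType) (a b c : K * K) : K :=
  ((b.1 - a.1) * (c.2 - a.2) - (b.2 - a.2) * (c.1 - a.1))%R.

Section StraightLine.
Local Open Scope classical_set_scope.
Local Open Scope ring_scope.
Variable R : realType.
Implicit Types a b c d p : R * R.

Definition line a b (t : R) : R * R := (a.1 + t * (b.1 - a.1), a.2 + t * (b.2 - a.2)).

Definition segment a b : set (R * R) := line a b @` `[0, 1].

Lemma segmentP a b p : segment a b p <-> exists t, [/\ 0 <= t, t <= 1 & line a b t = p].
Proof.
split=> [[t /= + <-]|[t [t0 t1 <-]]].
  by rewrite in_itv /= => /andP[t0 t1]; exists t.
by exists t => //=; rewrite in_itv /= t0.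
Qed.

Lemma segmentC a b : segment a b = segment b a.
Proof.
suff sub c d : segment c d `<=` segment d c by apply/seteqP; split; exact: sub.
move=> p /segmentP[t [t0 t1 <-]]; apply/segmentP; exists (1 - t).
by split; [lra | lra | rewrite /line; congr pair; ring].
Qed.

Lemma line_arc a b : a <> b -> arc_between a b (segment a b).
Proof.
move=> ab; exists (line a b); split=> //.
- have affine (u w : R) : continuous (fun t : R => u + t * w).
    move=> t; apply: (@cvgD _ R^o _ _ _ (fun=> u) (fun t => t * w)).
      exact: cvg_cst.
    exact: mulrr_continuous.
  by apply: continuous_subspaceT => t; 
    exact: (cvg_pair (affine a.1 (b.1 - a.1) t) (affine a.2 (b.2 - a.2) t)).
- move=> s t _ _ [/addrI e1 /addrI e2]; apply: contrapT => /eqP st.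
  apply: ab; case: a b e1 e2 => [a1 a2] [b1 b2] /= e1 e2.
  have zero (u w : R) : s * (w - u) = t * (w - u) -> u = w.
    move/eqP; rewrite -subr_eq0 -mulrBl mulf_eq0 !subr_eq0 (negPf st) /=.
    by move/eqP.
  by rewrite (zero _ _ e1) (zero _ _ e2).
- by case: a {ab} => a1 a2; rewrite /line /= !mul0r !addr0.
- by case: a b {ab} => a1 a2 [b1 b2]; rewrite /line /=; congr pair; ring.
Qed.

Lemma orient_line a b c d t :
  orient a b (line c d t) = (1 - t) * orient a b c + t * orient a b d.
Proof. by rewrite /orient /line /=; ring. Qed.

Lemma orient_segment a b p : segment a b p -> orient a b p = 0.
Proof. by move=> /segmentP[t [_ _ <-]]; rewrite orient_line /orient; ring. Qed.

Lemma segment_disjoint a b c d p : 0 < orient a b c * orient a b d ->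
  segment a b p -> segment c d p -> False.
Proof.
move=> h /orient_segment + /segmentP[t [t0 t1 pE]]; rewrite -pE orient_line.
move: (orient a b c) (orient a b d) h => u v uv E.
have h1 : (1 - t) * (u * u) + t * (u * v) = 0 by rewrite -(mulr0 u) -E; ring.
have u2 : 0 < u * u.
  by rewrite -expr2 exprn_even_gt0 //=; apply: contraTneq uv => ->; rewrite mul0r ltxx.
suff : 0 < (1 - t) * (u * u) + t * (u * v) by rewrite h1 ltxx.
have [->|t_neq1] := eqVneq t 1; first by rewrite subrr mul0r add0r mul1r.
apply: ltr_wpDr; first by rewrite mulr_ge0 // ltW.
by rewrite mulr_gt0 // subr_gt0 lt_neqAle t_neq1.
Qed.

Lemma segment_common a b d p : orient a b d != 0 ->
  segment a b p -> segment a d p -> p = a.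
Proof.
move=> h /orient_segment + /segmentP[t [t0 t1 pE]]; rewrite -pE orient_line.
have -> : orient a b a = 0 by rewrite /orient; ring.
rewrite mulr0 add0r => /eqP; rewrite mulf_eq0 (negPf h) orbF => /eqP ->.
by case: a {h pE} => a1 a2; rewrite /line /= !mul0r !addr0.
Qed.

(** In general position, edges with a common end meet nowhere else, and segments with four distinct
    ends are disjoint exactly when the line through one leaves the other on one side. *)
Lemma straight_line_planar (G : sgraph) (P : G -> R * R) : injective P ->
  (forall x y z, edge x y -> z != x -> z != y -> orient (P x) (P y) (P z) != 0) ->
  (forall x y x' y', edge x y -> edge x' y' ->
     x != x' -> x != y' -> y != x' -> y != y' ->
     0 < orient (P x) (P y) (P x') * orient (P x) (P y) (P y') \/
     0 < orient (P x') (P y') (P x) * orient (P x') (P y') (P y)) ->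
  planar R G.
Proof.
move=> P_inj generic disj.
exists P, (fun x y => segment (P x) (P y)).
have neq x y : edge x y -> x <> y by move=> /edge_neq/eqP.
have share x y y' p : edge x y -> edge x y' -> y != y' ->
    segment (P x) (P y) p -> segment (P x) (P y') p -> p = P x.
  move=> xy xy' yy'; apply: segment_common; apply: generic => //.
    by rewrite eq_sym edge_neq.
  by rewrite eq_sym.
have esym := @edge_sym G.
split=> //.
- by move=> x y /neq xy; apply: line_arc => /P_inj.
- by move=> x y _; exact: segmentC.
- move=> x y xy; apply/seteqP; split=> // p [[/orient_segment o0 ne] [z _ zE]].
  rewrite -zE in o0 ne.
  have zx : z != x by apply/eqP => E; apply: ne; left; rewrite /= E.
  have zy : z != y by apply/eqP => E; apply: ne; right; rewrite /= E.
  by have := generic x y z xy zx zy; rewrite o0 eqxx.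
move=> x y x' y' xy xy' ne; apply/seteqP; split=> // p [[pxy pne] pxy'].
have px : p <> P x by move=> E; apply: pne; left.
have py : p <> P y by move=> E; apply: pne; right.
have yx : edge y x by rewrite esym.
have yx' : edge y' x' by rewrite esym.
have pyx := pxy; rewrite segmentC in pyx; have pyx' := pxy'; rewrite segmentC in pyx'.
have [E|n1] := eqVneq x x'.
  subst x'; apply: px; apply: (share x y y') => //.
  by apply: contra_notN ne => /eqP->.
have [E|n2] := eqVneq x y'.
  subst y'; apply: px; apply: (share x y x') => //.
  by apply: contra_notN ne => /eqP->; rewrite setUC.
have [E|n3] := eqVneq y x'.
  subst x'; apply: py; apply: (share y x y') => //.
have [E|n4] := eqVneq y y'.
  subst y'; apply: py; apply: (share y x x') => //.
have [h|h] := disj x y x' y' xy xy' n1 n2 n3 n4.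
  exact: segment_disjoint h pxy pxy'.
exact: segment_disjoint h pxy' pxy.
Qed.

End StraightLine.

(** * Refuting colourability by exhaustive search *)

Section Refutation.
Variable k : nat.

(* Searches all colourings with colours introduced in increasing order; [rest]
   lists the remaining vertices with their neighbours, [used] counts the colours
   in use. The conditional is not a disjunction because [vm_compute] would
   evaluate both sides of the latter. *)
Fixpoint refutes (rest : seq (nat * seq nat)) (asg : seq (nat * nat)) (used : nat) : bool :=
  if rest is (v, nb) :: rest' then
    all (fun c => if has (fun p => (p.2 == c) && (p.1 \in nb)) asg then true
                  else refutes rest' ((v, c) :: asg) (maxn used c.+1))
        (iota 0 (minn used.+1 k))
  else false.

(** [col] is followed along the branch where each vertex receives the index of its colour in [us],
    the list of colours by first appearance. That branch can close only through a clash of [col]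
    itself. *)
Lemma refutes_sound (F : rel nat) (ord : seq nat) (col : nat -> 'I_k) :
  refutes [seq (v, [seq u <- ord | F u v]) | v <- ord] [::] 0 ->
  exists u v, [/\ u \in ord, v \in ord, F u v & col u = col v].
Proof.
set nb := fun v => [seq u <- ord | F u v].
suff H rest asg (us : seq 'I_k) : {subset rest <= ord} -> uniq us ->
    {in asg, forall p, (p.1 \in ord) && (col p.1 \in us) && (p.2 == index (col p.1) us)} ->
    refutes [seq (v, nb v) | v <- rest] asg (size us) ->
    exists u v, [/\ u \in ord, v \in ord, F u v & col u = col v].
  by apply: (H ord [::] [::]).
elim: rest asg us => [//|v rest IH] asg us sub us_uniq asgP /= /allP h.
have vo : v \in ord by apply: sub; exact: mem_head.
have sub' : {subset rest <= ord} by move=> u ur; apply: sub; rewrite inE ur orbT.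
pose us' := if col v \in us then us else rcons us (col v).
have us'_uniq : uniq us'.
  by rewrite /us'; case: ifP => // n; rewrite rcons_uniq n.
have vus' : col v \in us' by rewrite /us'; case: ifP => // _; rewrite mem_rcons mem_head.
have idx_us' c : c \in us -> (c \in us') && (index c us' == index c us).
  rewrite /us'; case: ifP => [_ ->|_ cus]; rewrite ?eqxx //.
  by rewrite mem_rcons inE cus orbT -cats1 index_cat cus eqxx.
have size_us' : size us' = maxn (size us) (index (col v) us').+1.
  rewrite /us'; case: ifP => [vus|nvus].
    by apply/esym/maxn_idPl; rewrite index_mem.
  by rewrite size_rcons -cats1 index_cat nvus /= eqxx addn0; apply/esym/maxn_idPr.
have card_us' : size us' <= k by rewrite -(card_uniqP us'_uniq) -[leqRHS]card_ord max_card.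
have idx_lt : index (col v) us' < size us' by rewrite index_mem.
have := h (index (col v) us'); rewrite mem_iota add0n leq0n /=.
have -> : index (col v) us' < minn (size us).+1 k.
  rewrite leq_min (leq_trans idx_lt card_us') andbT.
  apply: leq_trans idx_lt _; rewrite /us'; case: ifP => _ //.
  by rewrite size_rcons.
move=> /(_ isT); case: ifP => [/hasP[[u c] /asgP]|_].
  move=> /= /andP[/andP[uo uus] /eqP uc] /andP[/eqP cE uv] _.
  move: uv; rewrite mem_filter => /andP[Fuv _]; exists u, v; split=> //.
  have /andP[uus' /eqP E] := idx_us' _ uus.
  by rewrite -(nth_index (col u) uus') -[RHS](nth_index (col u) vus') E -cE uc.
rewrite -size_us'; apply: IH => // p; rewrite inE => /orP[/eqP->|/asgP] /=.
  by rewrite vo vus' eqxx.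
case/andP=> /andP[-> /idx_us'/andP[-> /eqP->]] ->.
by [].
Qed.

End Refutation.

(** Orientations need subtraction and are evaluated by [vm_compute], hence binary integers. *)
Definition integer_point (p : nat * nat) : BinNums.Z * BinNums.Z :=
  (BinInt.Z.of_nat p.1, BinInt.Z.of_nat p.2).

Section AdjacencyLists.
Variables (n : nat) (adj : seq (seq nat)).
Let nb i := nth [::] adj i.

Definition adj_sym : bool :=
  all (fun i => all (fun j => (j < n) && (i \in nb j)) (nb i)) (iota 0 n).
Definition adj_irrefl : bool := all (fun i => i \notin nb i) (iota 0 n).

Hypothesis hsym : adj_sym.
Hypothesis hirr : adj_irrefl.

Let list_edge : rel 'I_n := fun x y => val y \in nb (val x).

Let list_edge_sym : symmetric list_edge.
Proof.
suff sub x y : list_edge x y -> list_edge y x by move=> x y; apply/idP/idP; exact: sub.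
have /allP/(_ (val x)) := hsym; rewrite mem_iota ltn_ord => /(_ isT)/allP h.
by move=> /h/andP[].
Qed.

Let list_edge_irrefl : irreflexive list_edge.
Proof.
move=> x; have /allP/(_ (val x)) := hirr; rewrite mem_iota ltn_ord => /(_ isT).
exact: negPf.
Qed.

Definition list_graph : sgraph := SGraph list_edge_sym list_edge_irrefl.

Definition list_far i j : bool :=
  [&& i != j, j \notin nb i, ~~ has (fun z => j \in nb z) (nb i)
    & has (fun a => has (fun b => j \in nb b) (nb a)) (nb i)].

Lemma list_nb (x : 'I_n) j : j \in nb x -> exists y : 'I_n, val y = j.
Proof.
have /allP/(_ (val x)) := hsym; rewrite mem_iota ltn_ord => /(_ isT)/allP h.
by move=> /h/andP[lt _]; exists (Ordinal lt).
Qed.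

Lemma list_farP (x y : list_graph) : at_distance 3 x y <-> list_far (val x) (val y).
Proof.
rewrite at_distance3P; split.
  move=> [[a [b [xa ab by_]]] [xy nxy no]]; apply/and4P; split=> //.
    apply/hasPn => z xz; have [z' zE] := list_nb xz; rewrite -zE in xz *.
    exact: no xz.
  by apply/hasP; exists (val a) => //; apply/hasP; exists (val b).
move=> /and4P[xy nxy no /hasP[a xa /hasP[b ab by_]]]; split.
  have [a' aE] := list_nb xa; rewrite -aE in xa ab.
  have [b' bE] := list_nb ab; rewrite -bE in ab by_.
  by exists a', b'.
by split=> // z xz; have /hasPn/(_ _ xz) := no.
Qed.

Definition list_segments_ok (pos : seq (nat * nat)) : bool :=
  let P i := integer_point (nth (0, 0) pos i) in
  let V := iota 0 n in
  uniq (take n pos) && (size pos == n) &&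
  all (fun i => all (fun j =>
    all (fun z => (z == i) || (z == j) || (orient (P i) (P j) (P z) != 0%R)) V &&
    all (fun i' => all (fun j' =>
      [|| i == i', i == j', j == i', j == j',
          (0 < orient (P i) (P j) (P i') * orient (P i) (P j) (P j'))%R
        | (0 < orient (P i') (P j') (P i) * orient (P i') (P j') (P j))%R]) (nb i')) V)
    (nb i)) V.

End AdjacencyLists.

Section IntegerDrawing.
Local Open Scope ring_scope.
Variable R : realType.

Definition Zreal (z : BinNums.Z) : R := (int_of_Z z)%:~R.
Definition Zpoint (p : BinNums.Z * BinNums.Z) : R * R := (Zreal p.1, Zreal p.2).

Lemma ZrealB x y : Zreal (x - y) = Zreal x - Zreal y.
Proof. by rewrite /Zreal !rmorphB. Qed.

Lemma ZrealM x y : Zreal (x * y) = Zreal x * Zreal y.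
Proof. by rewrite /Zreal !rmorphM. Qed.

Lemma Zreal_inj : injective Zreal.
Proof. by move=> x y /intr_inj/(can_inj int_of_ZK). Qed.

Lemma Zreal_gt0 x : 0 < x -> 0 < Zreal x.
Proof.
rewrite /Zreal ltr0z; case: x => // p _; rewrite /int_of_Z /= ltz_nat.
exact/ssrnat.ltP/Pnat.Pos2Nat.is_pos.
Qed.

Lemma orient_Zpoint a b c : orient (Zpoint a) (Zpoint b) (Zpoint c) = Zreal (orient a b c).
Proof. by rewrite /orient /= !(ZrealB, ZrealM). Qed.

Lemma list_graph_planar n adj (hs : adj_sym n adj) (hi : adj_irrefl n adj) pos :
  list_segments_ok n adj pos -> planar R (list_graph hs hi).
Proof.
move=> /andP[/andP[pos_uniq /eqP pos_size]] /allP h.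
pose P (x : list_graph hs hi) := Zpoint (integer_point (nth (0, 0)%N pos (val x))).
have inV (x : 'I_n) : val x \in iota 0 n by rewrite mem_iota ltn_ord.
apply: (@straight_line_planar _ _ P).
- move=> x y [/Zreal_inj/Znat.Nat2Z.inj e1 /Zreal_inj/Znat.Nat2Z.inj e2]; apply/val_inj/eqP.
  rewrite -(nth_uniq (0, 0)%N _ _ pos_uniq) ?size_take ?pos_size ?ltnn ?ltn_ord //.
  rewrite !nth_take ?ltn_ord //; apply/eqP; move: e1 e2.
  by case: nth => ? ?; case: nth => ? ? /= -> ->.
- move=> x y z xy zx zy; rewrite orient_Zpoint.
  have /allP/(_ _ xy)/andP[/allP/(_ _ (inV z)) + _] := h _ (inV x).
  rewrite (negPf zx : (val z == val x) = false) (negPf zy : (val z == val y) = false) /=.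
  by apply: contraNneq => /(@Zreal_inj _ 0) ->.
move=> x y x' y' xy xy' n1 n2 n3 n4; rewrite !orient_Zpoint -!ZrealM.
have /allP/(_ _ xy)/andP[_ /allP/(_ _ (inV x'))/allP/(_ _ xy')] := h _ (inV x).
rewrite (negPf n1 : (val x == val x') = false) (negPf n2 : (val x == val y') = false).
rewrite (negPf n3 : (val y == val x') = false) (negPf n4 : (val y == val y') = false) /=.
by case/orP => /Zreal_gt0; [left | right].
Qed.

End IntegerDrawing.

(* A subgraph of the Apollonian network of depth four, together with
   vertices attached to some of its cliques; found by a computer search. *)
Definition G5_adj : seq (seq nat) :=
  [:: [:: 2; 3; 4; 5; 10; 11; 18; 28; 29]; [:: 2; 4; 6; 13; 14; 18; 26; 30];
    [:: 0; 1; 3; 5; 6; 8; 10; 12; 27; 30; 31];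
    [:: 0; 2; 4; 5; 6; 8; 13; 19; 20; 28; 32]; [:: 0; 1; 3; 26];
    [:: 0; 2; 3; 7; 8; 11; 12; 19; 21]; [:: 1; 2; 3; 9; 14; 22; 31; 32];
    [:: 5; 11; 23; 27]; [:: 2; 3; 5; 24]; [:: 6; 14; 25];
    [:: 0; 2; 15; 23]; [:: 0; 5; 7; 16]; [:: 2; 5]; [:: 1; 3; 25];
    [:: 1; 6; 9; 17]; [:: 10]; [:: 11]; [:: 14]; [:: 0; 1]; [:: 3; 5];
    [:: 3]; [:: 5]; [:: 6]; [:: 7; 10]; [:: 8]; [:: 9; 13]; [:: 1; 4];
    [:: 2; 7]; [:: 0; 3]; [:: 0]; [:: 1; 2]; [:: 2; 6]; [:: 3; 6]].

Definition G5_pos : seq (nat * nat) :=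
  [:: (0, 0); (90, 0); (45, 78); (45, 29); (48, 10); (32, 38); (61, 32);
    (25, 37); (40, 48); (64, 21); (23, 39); (17, 23); (38, 53); (68, 15);
    (73, 16); (30, 50); (25, 33); (67, 23); (46, 1); (36, 33); (34, 19);
    (19, 21); (55, 38); (17, 26); (43, 44); (58, 22); (66, 5); (34, 54);
    (21, 14); (15, 13); (69, 36); (54, 52); (53, 32)].

(** Any enumeration would be sound; the order governs only the size of the search. The hubs come
    last. *)
Definition G5_order : seq nat :=
  [:: 17; 22; 18; 25; 20; 26; 31; 19; 27; 29; 30; 32; 21; 24; 28; 12; 23; 4;
    16; 7; 15; 9; 13; 10; 8; 1; 11; 14; 6; 5; 0; 3; 2].

(** Proper for distance three only: the adjacent vertices 0 and 2 share a colour. *)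
Definition G5_colours : seq nat :=
  [:: 0; 3; 0; 0; 0; 0; 0; 4; 0; 1; 3; 4; 3; 0; 1; 2; 6; 6; 5; 0; 0; 2; 4; 4;
    1; 1; 2; 3; 0; 1; 3; 3; 0].

Lemma G5_sym : adj_sym 33 G5_adj. Proof. by vm_compute. Qed.
Lemma G5_irrefl : adj_irrefl 33 G5_adj. Proof. by vm_compute. Qed.

Definition G5 : sgraph := list_graph G5_sym G5_irrefl.

Lemma G5_planar (R : realType) : planar R G5.
Proof. by apply: (@list_graph_planar R _ _ _ _ G5_pos); vm_compute. Qed.

Lemma G5_chromatic : chromatic_number (exact_distance_graph G5 3 isT) = 7.
Proof.
apply/eqP; rewrite eqn_leq chromatic_number_le /=; last first.
  have lt7 (x : 'I_33) : nth 0 G5_colours (val x) < 7.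
    have : all (fun i => nth 0 G5_colours i < 7) (iota 0 33) by vm_compute.
    by move/allP; apply; rewrite mem_iota ltn_ord.
  apply/colourableP; exists (fun x : G5 => Ordinal (lt7 x)) => x y /list_farP xy.
  have : all (fun i => all (fun j => list_far G5_adj i j ==>
      (nth 0 G5_colours i != nth 0 G5_colours j)) (iota 0 33)) (iota 0 33).
    by vm_compute.
  move=> /allP/(_ (val x)); rewrite mem_iota ltn_ord => /(_ isT)/allP/(_ (val y)).
  by rewrite mem_iota ltn_ord => /(_ isT)/implyP/(_ xy).
rewrite leqNgt; apply/negP; rewrite /chromatic_number; case: ex_minnP => k.
move=> /colourableP[col colP] _; rewrite ltnS => k6.
have : refutes 6 [seq (v, [seq u <- G5_order | list_far G5_adj u v]) | v <- G5_order] [::] 0.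
  by vm_compute.
(* A colouring with [k] at most 6 is read as one with 6 colours; [inord] is applied only to entries
   of [G5_order], all below 33. *)
move/(@refutes_sound _ _ _ (fun i => widen_ord k6 (col (inord i : 'I_33)))).
move=> [u [v [uo vo Fuv /(congr1 val) /= /val_inj E]]].
have lt i : i \in G5_order -> i < 33.
  have : all (fun i => i < 33) G5_order by vm_compute.
  by move=> /allP; apply.
suff /colP : @edge (exact_distance_graph G5 3 isT) (inord u : 'I_33) (inord v : 'I_33).
  by rewrite E eqxx.
by apply/list_farP; rewrite /= !inordK ?lt.
Qed.

Theorem theorem1p4 (R : realType) :
  (forall G : sgraph, planar R G ->
     (chromatic_number (exact_distance_graph G 3 isT) <= 105)%N) /\
  (exists G5 : sgraph, planar R G5 /\
     chromatic_number (exact_distance_graph G5 3 isT) = 7%N).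
Proof.
split=> [G|]; first exact: planar_exact_distance3.
by exists G5; split; [exact: G5_planar | exact: G5_chromatic].
Qed.
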